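(* There is a universal constant $C>0$ such that the following holds. Let $X\sim N(0,\Sigma)$ be an SDD, $\kappa$-nondegenerate Gaussian graphical model on $n$ nodes with maximum degree $d\ge1$, and let $\delta\in(0,1)$. If $m\ge C\,\frac{d}{\kappa^4}\log(n/\delta)$, then with probability at least $1-\delta$ the algorithm \textsc{HybridMB}$(\tau,\gamma,d)$ with $\tau=\kappa^2/8$ and $\gamma=2$ returns the true neighborhood of every node, i.e. the returned edge set $E$ equals the edge set of the graph of the model.
   Context: A Gaussian graphical model (GGM) on $n$ nodes is a Gaussian vector $X=(X_1,\dots,X_n)\sim N(0,\Sigma)$ with invertible covariance $\Sigma$ and precision matrix $\Theta=\Sigma^{-1}$. Its graph has vertex set $\{1,\dots,n\}$, with distinct $i,j$ adjacent (neighbors) iff $\Theta_{ij}\neq0$. For $\kappa\in(0,1]$, the GGM is $\kappa$-nondegenerate if $|\Theta_{ij}|/\sqrt{\Theta_{ii}\Theta_{jj}}\ge\kappa$ for all $i\ne j$ with $\Theta_{ij}\ne0$. The GGM is SDD if $\Theta_{ii}\ge\sum_{j\neq i}|\Theta_{ij}|$ for every $i$. The data consist of three independent sample sets 1, 2, 3, each of $m$ i.i.d. copies of $X$; $\hat{\mathbb E}_2,\hat{\mathbb E}_3$ denote empirical expectation over sets 2 and 3. $\widehat{\mathrm{Var}}(X_k\mid X_j)$ denotes the ordinary least squares estimate of the conditional variance of $X_k$ given $X_j$ from sample set 1, i.e. $\frac1{m-1}\min_{b\in\mathbb R}\sum_{s=1}^m(X_k^{(s)}-bX_j^{(s)})^2$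 over the samples $X^{(1)},\dots,X^{(m)}$ of set 1. \textsc{WS-Regression}$(\gamma,d)$ for node $i$: (1) Choose $j\neq i$ minimizing $\widehat{\mathrm{Var}}(X_i\mid X_j)$. (2) Let $s_0^2=\exp\left(\lfloor\log(\widehat{\mathrm{Var}}(X_i\mid X_j)/(8d))\rfloor-1\right)$. (3) For $\ell=0,1,\dots,\lceil\log(8d)+3\rceil$: (a) let $s_\ell^2=s_0^2e^{\ell}$; (b) let $(w,a)$ be a minimizer of $\hat{\mathbb E}_2\left[\left(X_i-\sum_{k\notin\{i,j\}}w_k\frac{X_k}{\sqrt{\widehat{\mathrm{Var}}(X_k\mid X_j)}}-aX_j\right)^2\right]$ over $a\in\mathbb R$ and $w$ with $\|w\|_1\le\lambda$, where $\lambda=\sqrt{2d}\,s_\ell$; (c) let $\hat\sigma^2=\hat{\mathbb E}_3\left[\left(X_i-\sum_{k\notin\{i,j\}}w_k\frac{X_k}{\sqrt{\widehat{\mathrm{Var}}(X_k\mid X_j)}}-aX_j\right)^2\right]$, and exit the loop if $s_\ell^2\ge\gamma^2\hat\sigma^2$. (4) Return $w,a,j,\hat\sigma^2$. \textsc{HybridMB}$(\tau,\gamma,d)$: for every node $i$, run \textsc{WS-Regression}$(\gamma,d)$ for node $i$, obtaining $w(i),a(i),j(i),\hat\sigma^2(i)$. Define $u(i)_{j(i)}=a(i)$ and $u(i)_k=w(i)_k/\sqrt{\widehat{\mathrm{Var}}(X_k\mid X_{j(i)})}$ for $k\notin\{i,j(i)\}$. Return the set $E$ of all pairs $\{a,b\}$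 of distinct nodes such that $u(a)_b^2\,\hat\sigma^2(b)\ge\tau\,\hat\sigma^2(a)$ and $u(b)_a^2\,\hat\sigma^2(a)\ge\tau\,\hat\sigma^2(b)$. *)

(* Defs.v *)
From HB Require Import structures.
From mathcomp Require Import all_boot all_order all_algebra.
From mathcomp Require Import all_classical all_reals all_analysis.

Set Implicit Arguments.
Unset Strict Implicit.
Unset Printing Implicit Defensive.

Import Order.TTheory GRing.Theory Num.Theory.
Import numFieldNormedType.Exports.

Local Open Scope ring_scope.

(* The product rule over every subfamily of [I] is the case where the other
   sets are [setT]. *)
Definition mutually_independent (R : realType) (dT : measure_display)
    (T : measurableType dT) (P : probability T R) (dS : measure_display)
    (S : measurableType dS) (I : finType) (Y : I -> {RV P >-> S}) : Prop :=
  forall B : I -> set S, (forall i, measurable (B i)) ->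
    P (\bigcap_(i in [set: I]) (Y i @^-1` B i))%classic =
    (\big[*%E/1]_(i : I) P (Y i @^-1` B i)%classic)%E.

Arguments mutually_independent {R dT T} P {dS S I} Y.

(* [X ~ N(0, Sigma)]: [X] is a linear image [A *m Z] of a vector [Z] of
   independent standard normal variables, with [A *m A^T = Sigma].
   Asking for a square [A] and for [Z] on the same probability space is no
   restriction when [Sigma] is invertible, since then [Z] is [A^-1 X]. *)
Definition gaussian_vector (R : realType) (dT : measure_display)
    (T : measurableType dT) (P : probability T R) (n : nat)
    (Sigma : 'M[R]_n) (X : {RV P >-> n.-tuple R}) : Prop :=
  exists (A : 'M[R]_n) (Z : 'I_n -> {RV P >-> R}),
    [/\ A *m A^T = Sigma,
        mutually_independent P Z,
        forall k B, measurable B -> distribution P (Z k) B = normal_prob 0 1 B &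
        forall t k, tnth (X t) k = \sum_(l < n) A k l * Z l t].

Arguments gaussian_vector {R dT T} P {n} Sigma X.

Definition ggm_adjacent (R : realType) (n : nat) (Theta : 'M[R]_n) : rel 'I_n :=
  fun i j => (i != j) && (Theta i j != 0).

Definition max_degree (R : realType) (n : nat) (Theta : 'M[R]_n) : nat :=
  \max_(i < n) #|[set j | ggm_adjacent Theta i j]%SET|%N.

Definition kappa_nondegenerate (R : realType) (n : nat) (kappa : R)
    (Theta : 'M[R]_n) : Prop :=
  forall i j, i != j -> Theta i j != 0 ->
    kappa <= `|Theta i j| / Num.sqrt (Theta i i * Theta j j).

Definition SDD (R : realType) (n : nat) (Theta : 'M[R]_n) : Prop :=
  forall i, \sum_(j < n | j != i) `|Theta i j| <= Theta i i.

Definition edge_set (n : nat) (e : rel 'I_n) : {set {set 'I_n}} :=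
  [set [set p.1; p.2] | p : 'I_n * 'I_n & (p.1 != p.2) && e p.1 p.2]%SET.

Definition emp_mean (R : realType) (m n : nat) (x : 'I_m -> n.-tuple R)
    (f : n.-tuple R -> R) : R :=
  m%:R^-1 * \sum_(s < m) f (x s).

(* The infimum is attained, the function of [b] being a nonnegative quadratic
   polynomial. *)
Definition cond_var_hat (R : realType) (m n : nat) (x : 'I_m -> n.-tuple R)
    (k j : 'I_n) : R :=
  (m%:R - 1)^-1 *
  inf (range (fun b : R =>
    \sum_(s < m) (tnth (x s) k - b * tnth (x s) j) ^+ 2)).

(* In all that follows the weights [w] are indexed by [k \notin {i, j}]: the
   entries [w i] and [w j] are never read. *)
Definition l1_norm (R : realType) (n : nat) (i j : 'I_n) (w : 'I_n -> R) : R :=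
  \sum_(k < n | (k != i) && (k != j)) `|w k|.

Definition sq_loss (R : realType) (m n : nat) (x1 : 'I_m -> n.-tuple R)
    (i j : 'I_n) (w : 'I_n -> R) (a : R) (y : n.-tuple R) : R :=
  (tnth y i
   - \sum_(k < n | (k != i) && (k != j))
       w k * (tnth y k / Num.sqrt (cond_var_hat x1 k j))
   - a * tnth y j) ^+ 2.

Definition lasso_minimizer (R : realType) (m n : nat)
    (x1 x2 : 'I_m -> n.-tuple R) (i j : 'I_n) (lambda : R)
    (w : 'I_n -> R) (a : R) : Prop :=
  l1_norm i j w <= lambda /\
  forall (w' : 'I_n -> R) (a' : R), l1_norm i j w' <= lambda ->
    emp_mean x2 (sq_loss x1 i j w a) <= emp_mean x2 (sq_loss x1 i j w' a').

Record ws_result (R : realType) (n : nat) := WSResult {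
  ws_w : 'I_n -> R;
  ws_a : R;
  ws_j : 'I_n;
  ws_sigma2 : R }.

Definition s0_sq (R : realType) (m n : nat) (x1 : 'I_m -> n.-tuple R)
    (d : nat) (i j : 'I_n) : R :=
  expR ((Num.floor (ln (cond_var_hat x1 i j / (8 * d%:R))))%:~R - 1).

Definition s_sq (R : realType) (m n : nat) (x1 : 'I_m -> n.-tuple R)
    (d : nat) (i j : 'I_n) (l : nat) : R :=
  s0_sq x1 d i j * expR l%:R.

(* The ceiling is positive for [1 <= d], so that the absolute value is only a
   cast to [nat]. *)
Definition last_iter (R : realType) (d : nat) : nat :=
  `|Num.ceil (ln (8 * d%:R : R) + 3)|%N.

(* Minimizers need not be unique, so the algorithms are given by the relation
   between the data and all the results they may return.
   [ws_loop ... l r]: the loop entered at iteration [l] may end with [r]; when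
   the exit test never succeeds, the values of the last iteration are
   returned. *)
Inductive ws_loop (R : realType) (m n : nat) (x1 x2 x3 : 'I_m -> n.-tuple R)
    (gamma : R) (d : nat) (i j : 'I_n) : nat -> ws_result R n -> Prop :=
| WSStop l w a :
    let sigma2 := emp_mean x3 (sq_loss x1 i j w a) in
    lasso_minimizer x1 x2 i j
      (Num.sqrt (2 * d%:R) * Num.sqrt (s_sq x1 d i j l)) w a ->
    gamma ^+ 2 * sigma2 <= s_sq x1 d i j l \/ l = last_iter R d ->
    ws_loop x1 x2 x3 gamma d i j l (WSResult w a j sigma2)
| WSNext l w a r :
    let sigma2 := emp_mean x3 (sq_loss x1 i j w a) in
    lasso_minimizer x1 x2 i j
      (Num.sqrt (2 * d%:R) * Num.sqrt (s_sq x1 d i j l)) w a ->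
    s_sq x1 d i j l < gamma ^+ 2 * sigma2 ->
    (l < last_iter R d)%N ->
    ws_loop x1 x2 x3 gamma d i j l.+1 r ->
    ws_loop x1 x2 x3 gamma d i j l r.

Definition ws_regression (R : realType) (m n : nat)
    (x1 x2 x3 : 'I_m -> n.-tuple R) (gamma : R) (d : nat) (i : 'I_n)
    (r : ws_result R n) : Prop :=
  exists j : 'I_n,
    [/\ j != i,
        forall k, k != i -> cond_var_hat x1 i j <= cond_var_hat x1 i k &
        ws_loop x1 x2 x3 gamma d i j 0 r].

Definition regression_coef (R : realType) (m n : nat)
    (x1 : 'I_m -> n.-tuple R) (r : ws_result R n) (k : 'I_n) : R :=
  if k == ws_j r then ws_a r
  else ws_w r k / Num.sqrt (cond_var_hat x1 k (ws_j r)).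

Definition hybrid_mb (R : realType) (m n : nat)
    (x1 x2 x3 : 'I_m -> n.-tuple R) (tau gamma : R) (d : nat)
    (E : {set {set 'I_n}}) : Prop :=
  exists2 r : 'I_n -> ws_result R n,
    forall i, ws_regression x1 x2 x3 gamma d i (r i) &
    let u i k := regression_coef x1 (r i) k in
    let sigma2 i := ws_sigma2 (r i) in
    E = edge_set (fun a b =>
          (tau * sigma2 a <= u a b ^+ 2 * sigma2 b) &&
          (tau * sigma2 b <= u b a ^+ 2 * sigma2 a)).

(* Main.v *)
(* Fix a node i and the chosen j, and write V_k for the variance of X_k given
   X_j and sigma^2 = 1 / Theta_ii for the variance of X_i given all the rest.

   An SDD form dominates each edge term
   |Theta_ik| (x_i + sgn(Theta_ik) x_k)^2, so by duality the variance of
   X_i + sgn(Theta_ik) X_k is at most 1 / |Theta_ik|.  Hence some X_j leaves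
   X_i a conditional variance at most 2 d sigma^2, and for such a j the true
   regression vector has norm O(sqrt d sigma) in the basis of the X_k
   normalized by sqrt V_k.

   About the samples it suffices that the empirical second moments of finitely
   many fixed linear forms are close to the true ones.
   Forms with K = O(d / kappa^2) atoms need constant relative accuracy; a
   sparsification a la Maurey extends it to the whole l1 ball up to an
   additive error O(kappa^2 sigma^2).  The correlations of the true residual
   with the regressors need accuracy kappa^2 / sqrt d.

   The exit test can succeed only when the true vector is
   feasible, at a radius that is still O(sqrt d sigma).  The basic inequality
   of the Lasso then bounds the excess variance by kappa^2 sigma^2 / 64, and
   this is at least (error in the coefficient of X_k)^2 / Theta_kk, so that
   thresholding separates the edges from the non-edges. *)
Require Import Defs.
From HB Require Import structures.
From mathcomp Require Import all_boot all_order all_algebra.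
From mathcomp Require Import all_classical all_reals all_analysis.
From mathcomp Require Import measurable_realfun finmap ring lra.

Set Implicit Arguments.
Unset Strict Implicit.
Unset Printing Implicit Defensive.

Import Order.TTheory GRing.Theory Num.Theory.
Import numFieldNormedType.Exports.

Local Open Scope ring_scope.

(** * Bilinear forms and empirical covariance *)

(** The two accuracies differ because the two errors enter differently. The correlation of the
    residual with the regressors is multiplied by an l1 distance of order sqrt d sigma; to stay
    below kappa^2 sigma^2 it needs accuracy of order kappa^2 / sqrt d, and the inverse square d /
    kappa^4 of this accuracy is the sample size. The quadratic part needs only constant accuracy,
    but on about (2n)^N sparse sums with N of order d / kappa^2, which costs N log n samples, no
    more than the former. The coefficient of X_j is not penalized, so no l1 bound controls it. Hence
    all atoms are orthogonal to X_j, every sparse sum is tested together with X_j on the plane they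
    span, and the coefficient along X_j is bounded through the excess variance itself. The value
    gamma = 2 leaves a window for the loop: estimates are at least 0.8 sigma^2, so a successful test
    forces s^2 >= 3.2 sigma^2, where the true vector is feasible; once it is feasible the estimate
    is at most 1.2 sigma^2, so the loop cannot go on from s^2 above 4.8 sigma^2. *)

Definition bf (R : realType) (n : nat) (M : 'M[R]_n) (u v : 'rV[R]_n) : R :=
  (u *m M *m v^T) 0 0.

Section bilinear_form.
Context (R : realType) (n : nat) (M : 'M[R]_n).
Implicit Types u v w : 'rV[R]_n.

Lemma bfE u v : bf M u v = \sum_k \sum_l u 0 k * M k l * v 0 l.
Proof.
rewrite /bf mxE exchange_big /=; apply: eq_bigr => l _.
by rewrite mxE mulr_suml; apply: eq_bigr => k _; rewrite [v^T _ _]mxE.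
Qed.

Lemma bfDl u v w : bf M (u + v) w = bf M u w + bf M v w.
Proof. by rewrite /bf !mulmxDl mxE. Qed.

Lemma bfDr u v w : bf M u (v + w) = bf M u v + bf M u w.
Proof. by rewrite /bf linearD mulmxDr mxE. Qed.

Lemma bfZl a u v : bf M (a *: u) v = a * bf M u v.
Proof. by rewrite /bf -!scalemxAl mxE. Qed.

Lemma bfZr a u v : bf M u (a *: v) = a * bf M u v.
Proof. by rewrite /bf linearZ -scalemxAr mxE. Qed.

Lemma bfNl u v : bf M (- u) v = - bf M u v.
Proof. by rewrite -scaleN1r bfZl mulN1r. Qed.

Lemma bf0l v : bf M 0 v = 0.
Proof. by rewrite -(scale0r 0) bfZl mul0r. Qed.

Lemma bf0r u : bf M u 0 = 0.
Proof. by rewrite -(scale0r 0) bfZr mul0r. Qed.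

Lemma bf_suml (I : Type) (r : seq I) (P : pred I) (F : I -> 'rV[R]_n) v :
  bf M (\sum_(i <- r | P i) F i) v = \sum_(i <- r | P i) bf M (F i) v.
Proof. by elim/big_rec2: _ => [|i y u _ <-]; rewrite ?bf0l ?bfDl. Qed.

Lemma bf_sumr (I : Type) (r : seq I) (P : pred I) (F : I -> 'rV[R]_n) u :
  bf M u (\sum_(i <- r | P i) F i) = \sum_(i <- r | P i) bf M u (F i).
Proof. by elim/big_rec2: _ => [|i y v _ <-]; rewrite ?bf0r ?bfDr. Qed.

Hypothesis symM : M^T = M.

Lemma bfC u v : bf M u v = bf M v u.
Proof.
rewrite /bf -[RHS]/(((v *m M *m u^T) 0 0)) -[v *m M *m u^T]trmxK [RHS]mxE.
by rewrite trmx_mul trmxK trmx_mul symM mulmxA.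
Qed.

Lemma bf_sqD u v : bf M (u + v) (u + v) = bf M u u + 2 * bf M u v + bf M v v.
Proof. by rewrite bfDl !bfDr (bfC v u); ring. Qed.

Hypothesis psdM : forall u, 0 <= bf M u u.

Lemma bf_CS u v : bf M u v ^+ 2 <= bf M u u * bf M v v.
Proof.
have h t : 0 <= bf M u u + 2 * t * bf M u v + t ^+ 2 * bf M v v.
  by have := psdM (u + t *: v); rewrite bf_sqD !bfZl !bfZr; lra.
have [v0|v0] := eqVneq (bf M v v) 0.
  (* If [bf M u v] were nonzero, this argument would give the quadratic [h] the value -1. *)
  rewrite v0 mulr0; have := h (- (bf M u u + 1) / (2 * bf M u v)).
  have [->|uv0] := eqVneq (bf M u v) 0; first by rewrite expr0n.
  rewrite v0 mulr0 addr0.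
  have -> : 2 * (- (bf M u u + 1) / (2 * bf M u v)) * bf M u v = - (bf M u u + 1).
    by field; rewrite uv0.
  lra.
have vgt : 0 < bf M v v by rewrite lt_def v0 psdM.
have := h (- bf M u v / bf M v v).
have -> : bf M u u + 2 * (- bf M u v / bf M v v) * bf M u v +
   (- bf M u v / bf M v v) ^+ 2 * bf M v v =
   (bf M u u * bf M v v - bf M u v ^+ 2) / bf M v v by field.
by rewrite pmulr_lge0 ?invr_gt0// subr_ge0.
Qed.

Lemma bf_triangle u v :
  Num.sqrt (bf M (u + v) (u + v)) <= Num.sqrt (bf M u u) + Num.sqrt (bf M v v).
Proof.
rewrite -(@ler_pXn2r _ 2) ?nnegrE ?addr_ge0 ?sqrtr_ge0// sqr_sqrtr//.
rewrite sqrrD !sqr_sqrtr// bf_sqD lerD2r lerD2l -[leRHS]mulr_natl ler_wpM2l//.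
apply: le_trans (ler_norm _) _.
by rewrite -sqrtrM// -sqrtr_sqr ler_wsqrtr// bf_CS.
Qed.

End bilinear_form.

Definition lf (R : realType) (n : nat) (u : 'rV[R]_n) (x : n.-tuple R) : R :=
  \sum_k u 0 k * tnth x k.

Definition emp_cov (R : realType) (m n : nat) (x : 'I_m -> n.-tuple R) :
    'M[R]_n :=
  \matrix_(k, l) (m%:R^-1 * \sum_(s < m) tnth (x s) k * tnth (x s) l).

Section empirical_covariance.
Context (R : realType) (m n : nat) (x : 'I_m -> n.-tuple R).

Lemma bf_emp_cov u v :
  bf (emp_cov x) u v = m%:R^-1 * \sum_s lf u (x s) * lf v (x s).
Proof.
rewrite bfE; under eq_bigr do under eq_bigr do rewrite mxE.
transitivity (\sum_k \sum_l \sum_s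
    m%:R^-1 * (u 0 k * tnth (x s) k * (v 0 l * tnth (x s) l))).
  apply: eq_bigr => k _; apply: eq_bigr => l _.
  rewrite mulrAC mulrA mulr_sumr; apply: eq_bigr => s _; ring.
under eq_bigr do rewrite exchange_big/=.
rewrite exchange_big/= mulr_sumr; apply: eq_bigr => s _.
rewrite mulr_suml mulr_sumr; apply: eq_bigr => k _.
by rewrite -mulr_sumr -mulr_sumr.
Qed.

Lemma emp_cov_sym : (emp_cov x)^T = emp_cov x.
Proof.
apply/matrixP => k l; rewrite !mxE; congr (_ * _); apply: eq_bigr => s _.
exact: mulrC.
Qed.

Lemma emp_cov_ge0 u : 0 <= bf (emp_cov x) u u.
Proof.
rewrite bf_emp_cov mulr_ge0 ?invr_ge0// sumr_ge0// => s _.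
by rewrite -expr2 sqr_ge0.
Qed.

End empirical_covariance.

(** * Independence and chi-square concentration *)

Section density.
Context (R : realType) (dT dS : measure_display) (T : measurableType dT)
  (S : measurableType dS).
Local Open Scope classical_set_scope.
Local Open Scope ereal_scope.
Import HBNNSimple.

(* With [W = 1] this is the transfer formula, and with [Y = id] the integral
   against a density. *)
Lemma ge0_integral_weighted (mu : {measure set T -> \bar R})
    (nu : {measure set S -> \bar R}) (W : T -> R) (Y : T -> S) (f : S -> R) :
  measurable_fun [set: T] W -> (forall t, 0 <= W t)%R ->
  measurable_fun [set: T] Y ->
  (forall B, measurable B -> \int[mu]_t (W t * \1_B (Y t))%:E = nu B) ->
  measurable_fun [set: S] f -> (forall y, 0 <= f y)%R ->
  \int[mu]_t (W t * f (Y t))%:E = \int[nu]_y (f y)%:E.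
Proof.
move=> mW W0 mY WB mf f0.
have mEf : measurable_fun [set: S] (EFin \o f) by exact/measurable_EFinP.
have Ef0 y : [set: S] y -> 0 <= (EFin \o f) y by rewrite lee_fin.
pose f_ := nnsfun_approx measurableT mEf.
have mfn n : measurable_fun [set: T] (fun t => f_ n (Y t)).
  by apply: measurableT_comp.
have fn0 n y : (0 <= f_ n y)%R by [].
have ndf n m y : (n <= m)%N -> (f_ n y <= f_ m y)%R.
  by move=> nm; exact/lefP/nd_nnsfun_approx.
have fcv y : (fun n => (f_ n y)%:E) @ \oo --> (f y)%:E.
  exact: (@cvg_nnsfun_approx _ _ _ _ measurableT _ mEf Ef0 y I).
have mI n k : measurable_fun [set: T] (fun t => \1_(f_ n @^-1` [set k]) (Y t) : R).
  by apply: measurableT_comp => //; exact: measurable_indic.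
have fE n y : f_ n y =
    (\sum_(k <- fset_set (range (f_ n))) k * \1_(f_ n @^-1` [set k]) y)%R.
  by rewrite fimfunE fsbig_finite.
have kI n k y : (0 <= k * \1_(f_ n @^-1` [set k]) y)%R.
  rewrite indicE; case: (boolP (y \in _)) => yk; rewrite ?mulr0// mulr1.
  have <- : f_ n y = k by exact: set_mem yk.
  by [].
have Ek n k : \int[mu]_t (W t * (k * \1_(f_ n @^-1` [set k]) (Y t)))%:E =
    \int[nu]_y (k * \1_(f_ n @^-1` [set k]) y)%:E.
  (* A negative [k] is not a value of the nonnegative [f_ n], so its term vanishes on both sides;
     for the others the scalar [k] can be taken out of the integrals. *)
  have [k0|k0] := leP 0%R k; last first.
    have B0 y : (k * \1_(f_ n @^-1` [set k]) y = 0)%R.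
      apply/eqP; rewrite eq_le kI andbT; apply: mulr_le0_ge0 (ltW k0) _.
      by rewrite indicE.
    under eq_integral do rewrite B0 mulr0.
    under [in RHS]eq_integral do rewrite B0.
    by rewrite !integral0.
  under eq_integral do rewrite mulrCA EFinM.
  under [in RHS]eq_integral do rewrite EFinM.
  have mB : measurable (f_ n @^-1` [set k]) by [].
  rewrite ge0_integralZl_EFin//; last 2 first.
    by move=> t _; rewrite lee_fin mulr_ge0// indicE.
    by apply/measurable_EFinP; apply: measurable_funM.
  rewrite [RHS]ge0_integralZl_EFin//; last exact/measurable_EFinP.
  by rewrite (WB _ mB) integral_indic ?setIT.
have Efn n : \int[mu]_t (W t * f_ n (Y t))%:E = \int[nu]_y (f_ n y)%:E.
  under eq_integral do rewrite fE mulr_sumr -sumEFin.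
  under [in RHS]eq_integral do rewrite fE -sumEFin.
  rewrite ge0_integral_sum//; last 2 first.
    move=> k; apply/measurable_EFinP; apply: measurable_funM => //.
    by apply: measurable_funM => //.
    by move=> k t _; rewrite lee_fin mulr_ge0.
  rewrite ge0_integral_sum//; last 2 first.
    by move=> k; apply/measurable_EFinP; apply: measurable_funM => //.
    by move=> k t _; rewrite lee_fin.
  by apply: eq_bigr.
have cv1 : (fun n => \int[mu]_t (W t * f_ n (Y t))%:E) @ \oo -->
    \int[mu]_t (W t * f (Y t))%:E.
  have -> : (fun t => (W t * f (Y t))%:E) =
      (fun t => limn (fun n => (W t * f_ n (Y t))%:E)).
    apply/funext => t; apply/esym/cvg_lim => //; rewrite EFinM.
    by under eq_fun do rewrite EFinM; apply: cvgeZl.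
  apply: cvg_monotone_convergence => //.
  - by move=> n; apply/measurable_EFinP; apply: measurable_funM.
  - by move=> n t _; rewrite lee_fin mulr_ge0.
  - by move=> t _ n m nm; rewrite lee_fin ler_wpM2l// ndf.
have cv2 : (fun n => \int[nu]_y (f_ n y)%:E) @ \oo --> \int[nu]_y (f y)%:E.
  have -> : (fun y => (f y)%:E) = (fun y => limn (fun n => (f_ n y)%:E)).
    by apply/funext => t; apply/esym/cvg_lim.
  apply: cvg_monotone_convergence => //.
  - by move=> n; apply/measurable_EFinP.
  - by move=> n t _; rewrite lee_fin.
  - by move=> t _ n m nm; rewrite lee_fin ndf.
rewrite -(cvg_lim _ cv1)//; apply: cvg_lim => //.
by under eq_fun do rewrite Efn.
Qed.

End density.

Section independence.
Context (R : realType) (dT : measure_display) (T : measurableType dT)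
  (P : probability T R) (dS : measure_display) (S : measurableType dS).
Local Open Scope classical_set_scope.
Local Open Scope ereal_scope.

Lemma integral_indic_comp (Y : {RV P >-> S}) (B : set S) : measurable B ->
  \int[P]_t (\1_B (Y t) : R)%:E = P (Y @^-1` B).
Proof.
move=> mB; rewrite (_ : (fun t => _) = fun t => (\1_(Y @^-1` B) t)%:E)//.
rewrite integral_indic ?setIT//.
by rewrite -[X in measurable X]setTI; apply: measurable_funPT.
Qed.

(* Starting from indicators, the factors are replaced one at a time. *)
Lemma ge0_integral_prod_indep (I : finType) (Y : I -> {RV P >-> S})
    (f : I -> S -> R) :
  mutually_independent P Y ->
  (forall i, measurable_fun [set: S] (f i)) -> (forall i y, 0 <= f i y)%R ->
  (forall i, \int[P]_t (f i (Y i t))%:E < +oo) ->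
  \int[P]_t (\prod_i f i (Y i t))%:E = \prod_i \int[P]_t (f i (Y i t))%:E.
Proof.
move=> indY.
have mY i : measurable_fun [set: T] (Y i) by exact: measurable_funPT.
suff: forall (s : seq I) (g : I -> S -> R),
    (forall i, measurable_fun [set: S] (g i)) -> (forall i y, 0 <= g i y)%R ->
    (forall i, \int[P]_t (g i (Y i t))%:E < +oo) ->
    (forall i, i \notin s -> exists2 B, measurable B & g i = \1_B) ->
    \int[P]_t (\prod_i g i (Y i t))%:E = \prod_i \int[P]_t (g i (Y i t))%:E.
  move=> /(_ (enum I) f) h mf f0 foo; apply: h => // i.
  by rewrite mem_enum.
elim=> [g mg g0 goo gB|i s IH g mg g0 goo gB].
  have {}gB i : {B | measurable B & g i = \1_B} by exact/cid2/gB.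
  pose B i := s2val (gB i).
  have mB i : measurable (B i) by exact: s2valP (gB i).
  have gE i : g i = \1_(B i) by exact: s2valP' (gB i).
  under [RHS]eq_bigr do rewrite gE integral_indic_comp//.
  rewrite -indY//.
  set A := \bigcap_(i in _) _.
  have mA : measurable A.
    apply: fin_bigcap_measurable => // k _.
    by rewrite -[X in measurable X]setTI; exact: mY.
  rewrite -[RHS](_ : \int[P]_t (\1_A t)%:E = _); last first.
    by rewrite integral_indic ?setIT.
  apply: eq_integral => t _; congr EFin; rewrite indicE.
  under eq_bigr do rewrite gE indicE.
  case: (boolP (t \in A)) => tA.
    apply: big1 => k _; rewrite mem_set//.
    by have /(_ k) := set_mem tA; apply.
  have [k kB] : exists k, ~ B k (Y k t).
    by apply/existsNP => h; move/negP: tA; apply; apply/mem_set => k _; exact: h.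
  by rewrite (bigD1 k)//= memNset ?mul0r.
have gfin j : (\int[P]_t (g j (Y j t))%:E \is a fin_num)%E.
  by rewrite ge0_fin_numE// integral_ge0// => t _; rewrite lee_fin.
under eq_integral do rewrite (bigD1 i)//= mulrC.
pose c := (\prod_(j | j != i) fine (\int[P]_t (g j (Y j t))%:E))%R.
have cE : c%:E = \prod_(j | j != i) \int[P]_t (g j (Y j t))%:E.
  by rewrite -prodEFin; apply: eq_bigr => j _; rewrite fineK.
rewrite (bigD1 i)//= -cE muleC.
have c0 : (0 <= c)%R.
  apply: prodr_ge0 => j _; apply: fine_ge0; apply: integral_ge0 => t _.
  by rewrite lee_fin.
have mEg : measurable_fun [set: S] (fun y => (g i y)%:E) by exact/measurable_EFinP.
have g0E y : 0 <= (g i y)%:E by rewrite lee_fin.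
have -> : \int[P]_t (g i (Y i t))%:E = \int[distribution P (Y i)]_y (g i y)%:E.
  by rewrite ge0_integral_distribution.
have -> : c%:E * \int[distribution P (Y i)]_y (g i y)%:E =
    \int[mscale (NngNum c0) (distribution P (Y i))]_y (g i y)%:E.
  by rewrite ge0_integral_mscale.
(* The remaining factors act as a weight against the law of [Y i]. The identity then has to be
   tested on indicators only, where it is the induction hypothesis with [g i] replaced by [\1_B]. *)
apply: (@ge0_integral_weighted _ _ _ _ _ _ _
  (fun t => \prod_(j | j != i) g j (Y j t))%R) => //.
- under eq_fun do rewrite -big_filter.
  by apply: measurable_prod => j _; apply: measurableT_comp.
- by move=> t; exact: prodr_ge0.
move=> B mB; rewrite /mscale/= /pushforward.
pose g' j := if j == i then \1_B else g j.
have g'E j : j != i -> g' j = g j by rewrite /g' => /negbTE ->.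
have g'i : g' i = \1_B by rewrite /g' eqxx.
transitivity (\int[P]_t (\prod_j g' j (Y j t))%:E).
  apply: eq_integral => t _; rewrite [in RHS](bigD1 i)//= g'i [in RHS]mulrC.
  by congr (EFin (_ * _)%R); apply: eq_bigr => j ji; rewrite g'E.
rewrite IH.
- rewrite (bigD1 i)//= g'i integral_indic_comp// muleC; congr (_ * _).
  by rewrite cE; apply: eq_bigr => j ji; rewrite g'E.
- by move=> j; have [->|ji] := eqVneq j i; rewrite ?g'i ?g'E.
- by move=> j y; have [->|ji] := eqVneq j i; rewrite ?g'i ?g'E.
- move=> j; have [->|ji] := eqVneq j i; rewrite ?g'i ?g'E//.
  rewrite integral_indic_comp// (le_lt_trans (probability_le1 _ _)) ?ltry//.
  by rewrite -[X in measurable X]setTI; exact: mY.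
- move=> j js; have [->|ji] := eqVneq j i; rewrite ?g'i ?g'E//; first by exists B.
  by apply: gB; rewrite inE negb_or ji.
Qed.

End independence.

(** * Exponential moments of a standard normal variable and of its square *)

Section gaussian.
Context (R : realType).
Local Open Scope classical_set_scope.
Local Open Scope ereal_scope.
Let mu := @lebesgue_measure R.

Lemma ge0_integral_normal (m s : R) (f : R -> R) :
  measurable_fun [set: R] f -> (forall x, 0 <= f x)%R ->
  \int[normal_prob m s]_x (f x)%:E = \int[mu]_x (normal_pdf m s x * f x)%:E.
Proof.
move=> mf f0; apply/esym.
apply: (@ge0_integral_weighted _ _ _ _ _ mu _ (normal_pdf m s) id f) => //.
- exact: measurable_normal_pdf.
- exact: normal_pdf_ge0.
- move=> B mB; transitivity (\int[mu]_(x in B) (normal_pdf m s x)%:E); last by [].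
  rewrite [RHS]integral_mkcond.
  apply: eq_integral => x _; rewrite patchE indicE.
  by case: ifP => _; rewrite ?mulr1 ?mulr0.
Qed.

Lemma normal_mgf (s : R) :
  \int[normal_prob 0 1]_x (expR (s * x))%:E = (expR (s ^+ 2 / 2))%:E.
Proof.
rewrite ge0_integral_normal//; last first.
  by apply: measurableT_comp => //; exact: measurable_funM.
(* Completing the square: the exponential tilt is a shift of the mean. *)
have E x : (normal_pdf 0 1 x * expR (s * x) = expR (s ^+ 2 / 2) * normal_pdf s 1 x)%R.
  rewrite !normal_pdfE ?oner_eq0// mulrAC mulrCA -!mulrA; congr (_ * _)%R.
  rewrite /normal_fun -!expRD; congr expR.
  by field.
under eq_integral do rewrite E EFinM.
rewrite ge0_integralZl_EFin ?expR_ge0//; last 2 first.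
  by move=> x _; rewrite lee_fin normal_pdf_ge0.
  by apply/measurable_EFinP; exact: measurable_normal_pdf.
by rewrite integral_normal_pdf mule1.
Qed.

Lemma normal_sq_mgf (t : R) : (0 <= t)%R -> (2 * t < 1)%R ->
  \int[normal_prob 0 1]_x (expR (t * x ^+ 2))%:E = ((Num.sqrt (1 - 2 * t))^-1)%:E.
Proof.
move=> t0 t1.
rewrite ge0_integral_normal//; last first.
  by apply: measurableT_comp => //; apply: measurable_funM => //.
set r := Num.sqrt (1 - 2 * t).
have r0 : (0 < r)%R by rewrite sqrtr_gt0; lra.
have r2 : (r ^+ 2 = 1 - 2 * t)%R by rewrite sqr_sqrtr//; lra.
(* The quadratic tilt changes the standard deviation from 1 to [r^-1]. *)
have E x : (normal_pdf 0 1 x * expR (t * x ^+ 2) = r^-1 * normal_pdf 0 r^-1 x)%R.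
  rewrite !normal_pdfE ?oner_eq0// ?invr_eq0 ?gt_eqF//.
  rewrite mulrA -[LHS]mulrA; congr (_ * _)%R.
    rewrite /normal_peak expr1n mul1r -mulrnAr sqrtrM ?sqr_ge0// sqrtr_sqr.
    by rewrite ger0_norm ?invr_ge0 ?ltW// invfM invrK mulrA mulVf ?mul1r ?gt_eqF.
  rewrite /normal_fun -!expRD; congr expR.
  rewrite exprVn r2; field.
  by rewrite -r2 sqrf_eq0 gt_eqF.
under eq_integral do rewrite E EFinM.
rewrite ge0_integralZl_EFin ?invr_ge0 ?(ltW r0)//; last 2 first.
  by move=> x _; rewrite lee_fin normal_pdf_ge0.
  by apply/measurable_EFinP; exact: measurable_normal_pdf.
by rewrite integral_normal_pdf mule1.
Qed.

End gaussian.

Section chi2.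
Context (R : realType) (dT : measure_display) (T : measurableType dT)
  (P : probability T R).
Local Open Scope classical_set_scope.
Local Open Scope ereal_scope.

Lemma lin_comb_mgf (I : finType) (Z : I -> {RV P >-> R}) (c : I -> R) (s : R) :
  mutually_independent P Z ->
  (forall k B, measurable B -> distribution P (Z k) B = normal_prob 0 1 B) ->
  \int[P]_t (expR (s * \sum_k c k * Z k t))%:E =
  (expR (s ^+ 2 * (\sum_k c k ^+ 2) / 2))%:E.
Proof.
move=> indZ lawZ.
have E k : \int[P]_t (expR (s * c k * Z k t))%:E = (expR ((s * c k) ^+ 2 / 2))%:E.
  rewrite -normal_mgf; under eq_integral do rewrite -[expR _]mul1r.
  apply: (@ge0_integral_weighted R dT _ T (measurableTypeR R) P
    (normal_prob 0 1) (cst 1%R) (Z k) (fun x => expR (s * c k * x))) => //.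
  - exact: (measurable_funPT (Z k)).
  - move=> B mB; transitivity (distribution P (Z k) B); last exact: lawZ.
    under eq_integral do rewrite mul1r.
    exact: integral_indic_comp.
  - by apply: measurableT_comp => //; exact: measurable_funM.
have <- : \prod_k \int[P]_t (expR (s * c k * Z k t))%:E =
    (expR (s ^+ 2 * (\sum_k c k ^+ 2) / 2))%:E.
  rewrite (eq_bigr _ (fun k _ => E k)) prodEFin -expR_sum; congr (expR _)%:E.
  by rewrite mulr_sumr mulr_suml; apply: eq_bigr => k _; rewrite exprMn.
rewrite -(@ge0_integral_prod_indep _ _ _ _ _ _ _ Z (fun k x => expR (s * c k * x)))//.
- apply: eq_integral => t _; rewrite -expR_sum mulr_sumr; congr (expR _)%:E.
  by apply: eq_bigr => k _; rewrite mulrA.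
- by move=> k; apply: measurableT_comp => //; exact: measurable_funM.
- by move=> k; rewrite E ltry.
Qed.

(* Writing [exp (t Y^2)] as a Gaussian mean of [exp (sqrt (2 t) g Y)] reduces
   the square to the moment generating function of [Y]. *)
Lemma sq_mgf (Y : {RV P >-> R}) (q t : R) :
  (forall s, \int[P]_w (expR (s * Y w))%:E = (expR (s ^+ 2 * q / 2))%:E) ->
  (0 <= q)%R -> (0 <= t)%R -> (2 * (t * q) < 1)%R ->
  \int[P]_w (expR (t * Y w ^+ 2))%:E = ((Num.sqrt (1 - 2 * (t * q)))^-1)%:E.
Proof.
move=> mgf q0 t0 tq.
pose f (z : T * R) := (expR (Num.sqrt (2 * t) * z.2 * Y z.1))%:E.
have r2 : (Num.sqrt (2 * t) ^+ 2 = 2 * t)%R by rewrite sqr_sqrtr// mulr_ge0.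
have mf : measurable_fun [set: T * R] f.
  apply/measurable_EFinP; apply: measurableT_comp => //.
  apply: measurable_funM; first by apply: measurable_funM.
  by apply: measurableT_comp => //; exact: measurable_fst.
have f0 z : 0 <= f z by rewrite lee_fin expR_ge0.
have := @fubini_tonelli _ _ _ _ R P (normal_prob 0 1) f mf f0.
rewrite /fubini_F /fubini_G /f/=.
under eq_integral.
  move=> w _.
  under eq_integral do rewrite mulrAC.
  rewrite normal_mgf exprMn r2.
  rewrite (_ : 2 * t * Y w ^+ 2 / 2 = t * Y w ^+ 2)%R; last by field.
  over.
move=> ->.
under eq_integral.
  move=> x _.
  rewrite mgf exprMn r2.
  rewrite (_ : 2 * t * x ^+ 2 * q / 2 = t * q * x ^+ 2)%R; last by field.
  over.
by rewrite normal_sq_mgf// mulr_ge0.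
Qed.

End chi2.

Section tails.
Context (R : realType) (dT : measure_display) (T : measurableType dT)
  (P : probability T R).
Local Open Scope classical_set_scope.
Local Open Scope ereal_scope.

Lemma inv_sqrt_le_expR (x : R) : (0 <= x <= 1 / 4)%R ->
  ((Num.sqrt (1 - 2 * x))^-1 <= expR (x + 4 * x ^+ 2))%R.
Proof.
move=> /andP[x0 x4].
have r0 : (0 < Num.sqrt (1 - 2 * x))%R by rewrite sqrtr_gt0; lra.
have s0 : (0 <= expR (x + 4 * x ^+ 2) * Num.sqrt (1 - 2 * x))%R.
  by rewrite mulr_ge0 ?expR_ge0 ?sqrtr_ge0.
rewrite -[leLHS]mul1r ler_pdivrMr// -(@ler_pXn2r _ 2) ?nnegrE//.
rewrite expr1n exprMn sqr_sqrtr; last lra.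
rewrite -expRM_natr.
have := expR_ge1Dx ((x + 4 * x ^+ 2) * 2%:R)%R.
set e := expR _ => he.
(* The product equals 1 + 4 x^2 (1 - 4 x), whence the range x <= 1/4. *)
apply: (@le_trans _ _ ((1 + (x + 4 * x ^+ 2) * 2) * (1 - 2 * x))%R).
  have : (0 <= x ^+ 2 * (1 - 4 * x))%R by rewrite mulr_ge0 ?sqr_ge0; lra.
  lra.
by apply: ler_wpM2r; first lra.
Qed.

Lemma sq_mgf_le (Y : {RV P >-> R}) (q x : R) :
  (forall s, \int[P]_w (expR (s * Y w))%:E = (expR (s ^+ 2 * q / 2))%:E) ->
  (0 < q)%R -> (0 <= x <= 1 / 4)%R ->
  \int[P]_w (expR (x / q * Y w ^+ 2))%:E <= (expR (x + 4 * x ^+ 2))%:E.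
Proof.
move=> mgf q0 /andP[x0 x4].
have xq : (x / q * q = x)%R by rewrite divfK// gt_eqF.
rewrite (sq_mgf mgf (ltW q0)) ?divr_ge0 ?(ltW q0)// xq; last lra.
by rewrite lee_fin inv_sqrt_le_expR// x0.
Qed.

(** The difference exp(-a) + exp a - 2 is exp(-a) (exp a - 1)^2, and exp a - 1 <= a exp a. *)
Lemma two_cosh_le (a : R) : (0 <= a)%R ->
  (expR (- a) + expR a <= 2 + a ^+ 2 * expR a)%R.
Proof.
move=> a0.
have e0 := expR_gt0 a; have f0 := expR_gt0 (- a).
have ef : (expR a * expR (- a) = 1)%R by rewrite -expRD subrr expR0.
have h : (1 - a <= expR (- a))%R by exact: expR_ge1Dx.
have h2 : (expR a - 1 <= a * expR a)%R.
  by have := ler_wpM2l (ltW e0) h; rewrite ef; lra.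
have h3 : (0 <= expR a - 1)%R by rewrite subr_ge0 -expR0 ler_expR.
have : ((expR a - 1) ^+ 2 <= (a * expR a) ^+ 2)%R.
  by rewrite lerXn2r ?nnegrE// mulr_ge0// ltW.
move/(ler_wpM2l (ltW f0)).
have -> : (expR (- a) * (expR a - 1) ^+ 2 =
  expR a * (expR a * expR (- a)) - 2 * (expR a * expR (- a)) + expR (- a))%R by ring.
have -> : (expR (- a) * (a * expR a) ^+ 2 =
  a ^+ 2 * expR a * (expR a * expR (- a)))%R by ring.
by rewrite ef; lra.
Qed.

(** The factor w^2 and the exponential exp(x w) are each absorbed by exp(w / 8). The resulting
    exponent 1/4 stays below 1/2, where the exponential moment of a squared standard normal variable
    becomes infinite. *)
Lemma sq_le_expR (x w : R) : (0 <= x <= 1 / 8)%R -> (0 <= w)%R ->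
  ((x * w) ^+ 2 * expR (x * w) <= 256 * x ^+ 2 * expR (1 / 4 * w))%R.
Proof.
move=> /andP[x0 x8] w0.
have h1 : (w ^+ 2 <= 256 * expR (1 / 8 * w))%R.
  have -> : (1 / 8 * w = (1 / 16 * w) * 2%:R)%R by field.
  rewrite expRM_natr.
  have h := expR_ge1Dx (1 / 16 * w)%R.
  have : ((1 / 16 * w) ^+ 2 <= expR (1 / 16 * w) ^+ 2)%R.
    by rewrite lerXn2r ?nnegrE ?expR_ge0//; lra.
  by rewrite exprMn; lra.
have h2 : (expR (x * w) <= expR (1 / 8 * w))%R by rewrite ler_expR; nra.
have -> : (1 / 4 * w = 1 / 8 * w + 1 / 8 * w)%R by field.
rewrite expRD exprMn.
apply: (@le_trans _ _ (x ^+ 2 * (256 * expR (1 / 8 * w)) * expR (1 / 8 * w))%R).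
  apply: ler_pM; rewrite ?expR_ge0 ?mulr_ge0 ?sqr_ge0//.
  by rewrite ler_wpM2l ?sqr_ge0.
lra.
Qed.

(* [exp (- a) <= 2 - exp a + a^2 exp a], so that the negative exponential
   moment is bounded through positive ones only. *)
Lemma sq_mgf_neg_le (Y : {RV P >-> R}) (q x : R) :
  (forall s, \int[P]_w (expR (s * Y w))%:E = (expR (s ^+ 2 * q / 2))%:E) ->
  (0 < q)%R -> (0 <= x <= 1 / 8)%R ->
  \int[P]_w (expR (- (x / q * Y w ^+ 2)))%:E <= (expR (- x + 512 * x ^+ 2))%:E.
Proof.
move=> mgf q0 /andP[x0 x8].
pose a w := (x / q * Y w ^+ 2)%R.
have a0 w : (0 <= a w)%R by rewrite mulr_ge0 ?divr_ge0 ?sqr_ge0// ltW.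
have ma : measurable_fun [set: T] a.
  by apply: measurable_funM => //; apply: measurable_funX.
have e0 b : (0 <= expR b :> R)%R := expR_ge0 b.
have mea : measurable_fun [set: T] (fun w => expR (a w)) by exact: measurableT_comp.
have mena : measurable_fun [set: T] (fun w => expR (- a w)).
  by apply: measurableT_comp => //; exact: measurableT_comp.
have me4 : measurable_fun [set: T] (fun w => expR (1 / 4 / q * Y w ^+ 2)).
  by apply: measurableT_comp => //; apply: measurable_funM => //; apply: measurable_funX.
have I1 : \int[P]_w (expR (a w))%:E = ((Num.sqrt (1 - 2 * x))^-1)%:E.
  have xq : (x / q * q = x)%R by rewrite divfK// gt_eqF.
  by rewrite (sq_mgf mgf (ltW q0)) ?divr_ge0 ?(ltW q0)// xq//; lra.
have I4 : \int[P]_w (expR (1 / 4 / q * Y w ^+ 2))%:E <= 2%:E.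
  have xq : (1 / 4 / q * q = 1 / 4)%R by rewrite divfK// gt_eqF.
  rewrite (sq_mgf mgf (ltW q0)) ?divr_ge0 ?(ltW q0)// xq; last lra.
  rewrite lee_fin -[leRHS]invrK lef_pV2 ?posrE ?sqrtr_gt0; [|lra|lra].
  rewrite -(@ler_pXn2r _ 2) ?nnegrE ?sqrtr_ge0 ?invr_ge0//.
  by rewrite sqr_sqrtr; lra.
(* Subtracting this lower bound for the positive moment from the bound 2 + 512 x^2 on the sum of
   both moments leaves 1 - x + 512 x^2. *)
have I1ge : (1 + x <= (Num.sqrt (1 - 2 * x))^-1)%R.
  have r0 : (0 < Num.sqrt (1 - 2 * x))%R by rewrite sqrtr_gt0; lra.
  have s0 : (0 <= (1 + x) * Num.sqrt (1 - 2 * x))%R by rewrite mulr_ge0 ?sqrtr_ge0//; lra.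
  rewrite -[leRHS]mul1r ler_pdivlMr// -(@ler_pXn2r _ 2) ?nnegrE//.
  rewrite expr1n exprMn sqr_sqrtr; last lra.
  have : (0 <= x ^+ 2 * (3 + 2 * x))%R by rewrite mulr_ge0 ?sqr_ge0; lra.
  lra.
have [K KE] : exists K, K = (256 * x ^+ 2)%R by exists (256 * x ^+ 2)%R.
have K0 : (0 <= K)%R by have := sqr_ge0 x; rewrite KE; lra.
have S : \int[P]_w (expR (- a w))%:E + \int[P]_w (expR (a w))%:E <=
    2%:E + K%:E * \int[P]_w (expR (1 / 4 / q * Y w ^+ 2))%:E.
  rewrite -ge0_integralD//; last 2 first.
    by apply/measurable_EFinP.
    by apply/measurable_EFinP.
  rewrite -ge0_integralZl_EFin//; last exact/measurable_EFinP.
  have -> : 2%:E = \int[P]_w (2%:E : \bar R).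
    rewrite integral_cst//=; have -> : P setT = 1 by exact: probability_setT.
    by rewrite mule1.
  rewrite -ge0_integralD//; last 2 first.
    by move=> w _; rewrite -EFinM lee_fin mulr_ge0.
    by apply/measurable_EFinP; apply: measurable_funM.
  apply: ge0_le_integral => //.
  - by move=> w _; rewrite -EFinD lee_fin addr_ge0.
  - by apply/measurable_EFinP; apply: measurable_funD.
  - by apply/measurable_EFinP; apply: measurable_funD => //; apply: measurable_funM.
  - move=> w _; rewrite -EFinM -!EFinD lee_fin.
    apply: le_trans (two_cosh_le (a0 w)) _; rewrite lerD2l.
    have -> : (a w = x * (Y w ^+ 2 / q))%R by rewrite /a; field; rewrite gt_eqF.
    have -> : (1 / 4 / q * Y w ^+ 2 = 1 / 4 * (Y w ^+ 2 / q))%R.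
      by field; rewrite gt_eqF.
    by rewrite KE; apply: sq_le_expR; rewrite ?x0// divr_ge0 ?sqr_ge0// ltW.
rewrite I1 in S.
have {S} : \int[P]_w (expR (- a w))%:E + (1 + x)%:E <= (2 + 512 * x ^+ 2)%:E.
  apply: (@le_trans _ _ (\int[P]_w (expR (- a w))%:E + ((Num.sqrt (1 - 2 * x))^-1)%:E)).
    by rewrite leeD2l// lee_fin.
  apply: le_trans S _; rewrite [leRHS]EFinD; apply: leeD2l.
  apply: (@le_trans _ _ (K%:E * 2%:E)).
    by rewrite lee_wpmul2l// lee_fin.
  by rewrite -EFinM lee_fin KE; lra.
rewrite -leeBrDr// => /le_trans; apply.
rewrite -EFinB lee_fin.
by apply: le_trans (expR_ge1Dx _); lra.
Qed.

End tails.

Section concentration.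
Context (R : realType) (dT : measure_display) (T : measurableType dT)
  (P : probability T R).
Local Open Scope classical_set_scope.
Local Open Scope ereal_scope.

Lemma chernoff (dS : measure_display) (S : measurableType dS) (I : finType)
    (X : I -> {RV P >-> S}) (g : S -> R) (M a : R) :
  mutually_independent P X -> measurable_fun [set: S] g ->
  (forall s, \int[P]_t (expR (g (X s t)))%:E <= (expR M)%:E) ->
  P [set t | (a <= \sum_s g (X s t))%R] <= (expR (#|I|%:R * M - a))%:E.
Proof.
move=> indX mg mgf.
have mX s : measurable_fun [set: T] (X s) by exact: measurable_funPT.
have mgX s : measurable_fun [set: T] (fun t => g (X s t)) by exact: measurableT_comp.
have mS : measurable_fun [set: T] (fun t => \sum_s g (X s t))%R by exact: measurable_sum.
set A := [set t | _].
have mA : measurable A.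
  rewrite -[A]setTI.
  exact: (measurable_fun_le measurableT (measurable_cst a) mS).
rewrite (_ : P A = \int[P]_t (\1_A t)%:E); last by rewrite integral_indic ?setIT.
have mE : measurable_fun [set: T] (fun t => expR (\sum_s g (X s t)))%R.
  exact: measurableT_comp.
apply: (@le_trans _ _ (\int[P]_t ((expR (- a))%:E * (expR (\sum_s g (X s t)))%:E))).
  apply: ge0_le_integral => //.
  - by apply/measurable_EFinP.
  - by apply/measurable_EFinP; apply: measurable_funM.
  - move=> t _; rewrite -EFinM lee_fin -expRD indicE.
    case: (boolP (t \in A)) => tA; last exact: expR_ge0.
    rewrite -[leLHS]expR0 ler_expR.
    by have := set_mem tA; rewrite /A/=; lra.
rewrite ge0_integralZl_EFin ?expR_ge0//; last exact/measurable_EFinP.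
rewrite addrC expRD EFinM lee_wpmul2l ?lee_fin ?expR_ge0//.
under eq_integral do rewrite expR_sum.
rewrite (@ge0_integral_prod_indep _ _ _ _ _ _ _ X (fun _ x => expR (g x)))//; last 2 first.
- by move=> _; exact: measurableT_comp.
- by move=> s; rewrite (le_lt_trans (mgf s))// ltry.
rewrite expRM_natl cardE -big_enum/=.
elim: (enum I) => [|s r IH]; first by rewrite big_nil expr0.
rewrite big_cons/= exprS EFinM lee_pmul// ?prode_ge0//.
- by apply: integral_ge0 => t _; rewrite lee_fin expR_ge0.
- by move=> k _; apply: integral_ge0 => t _; rewrite lee_fin expR_ge0.
Qed.


Lemma chi2_upper_tail (dS : measure_display) (S : measurableType dS) (m : nat)
    (X : 'I_m -> {RV P >-> S}) (h : {mfun S >-> R}) (q e : R) :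
  mutually_independent P X ->
  (forall s r, \int[P]_t (expR (r * h (X s t)))%:E = (expR (r ^+ 2 * q / 2))%:E) ->
  (0 < q)%R -> (0 < e <= 1)%R ->
  P [set t | (q * (1 + e) * m%:R <= \sum_s h (X s t) ^+ 2)%R] <=
    (expR (- (m%:R * e ^+ 2 / 2048)))%:E.
Proof.
move=> indX mgf q0 /andP[e0 e1].
(* The Chernoff exponent is m (4 x^2 - x e), minimal at this x, with value - m e^2 / 16. *)
pose x := (e / 8)%R; have x0 : (0 <= x <= 1 / 4)%R by rewrite /x; lra.
have mX s : measurable_fun [set: T] (X s) by exact: measurable_funPT.
have mh : measurable_fun [set: S] h by exact: measurable_funPT.
have mg : measurable_fun [set: S] (fun y => x / q * h y ^+ 2)%R.
  by apply: measurable_funM => //; apply: measurable_funX.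
have gX s : \int[P]_t (expR (x / q * h (X s t) ^+ 2))%:E <= (expR (x + 4 * x ^+ 2))%:E.
  exact: (@sq_mgf_le _ _ _ P (h \o X s) q x (mgf s) q0 x0).
have xq : (0 < x / q)%R by rewrite divr_gt0// /x; lra.
have -> : [set t | (q * (1 + e) * m%:R <= \sum_s h (X s t) ^+ 2)%R] =
    [set t | (x * (1 + e) * m%:R <= \sum_s x / q * h (X s t) ^+ 2)%R].
  apply/funext => t /=; rewrite -mulr_sumr.
  have -> : (x * (1 + e) * m%:R = x / q * (q * (1 + e) * m%:R))%R.
    by field; rewrite gt_eqF.
  by rewrite ler_pM2l.
have := chernoff (x * (1 + e) * m%:R) indX mg gX.
rewrite card_ord => /le_trans; apply.
rewrite lee_fin ler_expR /x.
have : (0 <= m%:R * e ^+ 2 :> R)%R by rewrite mulr_ge0 ?sqr_ge0.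
lra.
Qed.

Lemma chi2_lower_tail (dS : measure_display) (S : measurableType dS) (m : nat)
    (X : 'I_m -> {RV P >-> S}) (h : {mfun S >-> R}) (q e : R) :
  mutually_independent P X ->
  (forall s r, \int[P]_t (expR (r * h (X s t)))%:E = (expR (r ^+ 2 * q / 2))%:E) ->
  (0 < q)%R -> (0 < e <= 1)%R ->
  P [set t | (\sum_s h (X s t) ^+ 2 <= q * (1 - e) * m%:R)%R] <=
    (expR (- (m%:R * e ^+ 2 / 2048)))%:E.
Proof.
move=> indX mgf q0 /andP[e0 e1].
(* Here the exponent is m (512 x^2 - x e), with minimal value - m e^2 / 2048; this is the origin of
   the constant used for both tails. *)
pose x := (e / 1024)%R; have x0 : (0 <= x <= 1 / 8)%R by rewrite /x; lra.
have mg : measurable_fun [set: S] (fun y => - (x / q * h y ^+ 2))%R.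
  apply: measurableT_comp => //.
  by apply: measurable_funM => //; apply: measurable_funX.
have gX s : \int[P]_t (expR (- (x / q * h (X s t) ^+ 2)))%:E <=
    (expR (- x + 512 * x ^+ 2))%:E.
  exact: (@sq_mgf_neg_le _ _ _ P (h \o X s) q x (mgf s) q0 x0).
have xq : (0 < x / q)%R by rewrite divr_gt0// /x; lra.
have -> : [set t | (\sum_s h (X s t) ^+ 2 <= q * (1 - e) * m%:R)%R] =
    [set t | (- (x * (1 - e) * m%:R) <= \sum_s - (x / q * h (X s t) ^+ 2))%R].
  apply/funext => t /=; rewrite sumrN -mulr_sumr.
  have -> : (x * (1 - e) * m%:R = x / q * (q * (1 - e) * m%:R))%R.
    by field; rewrite gt_eqF.
  by rewrite lerN2 ler_pM2l.
have := chernoff (- (x * (1 - e) * m%:R)) indX mg gX.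
rewrite card_ord => /le_trans; apply.
rewrite lee_fin ler_expR /x.
lra.
Qed.

Lemma chi2_tail (dS : measure_display) (S : measurableType dS) (m : nat)
    (X : 'I_m -> {RV P >-> S}) (h : {mfun S >-> R}) (q e : R) :
  mutually_independent P X ->
  (forall s r, \int[P]_t (expR (r * h (X s t)))%:E = (expR (r ^+ 2 * q / 2))%:E) ->
  (0 < q)%R -> (0 < e <= 1)%R -> (0 < m)%N ->
  exists B, [/\ measurable B, P B <= (2 * expR (- (m%:R * e ^+ 2 / 2048)))%:E &
    forall t, ~ B t ->
      (`|m%:R^-1 * (\sum_s h (X s t) ^+ 2) - q| <= e * q)%R].
Proof.
move=> indX mgf q0 e01 m0.
have mX s : measurable_fun [set: T] (X s) by exact: measurable_funPT.
have mS : measurable_fun [set: T] (fun t => \sum_s h (X s t) ^+ 2)%R.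
  apply: measurable_sum => s; apply: measurable_funX.
  by apply: measurableT_comp.
set B1 := [set t | (q * (1 + e) * m%:R <= \sum_s h (X s t) ^+ 2)%R].
set B2 := [set t | (\sum_s h (X s t) ^+ 2 <= q * (1 - e) * m%:R)%R].
have mB1 : measurable B1.
  rewrite -[B1]setTI; exact: (measurable_fun_le measurableT (measurable_cst _) mS).
have mB2 : measurable B2.
  rewrite -[B2]setTI; exact: (measurable_fun_le measurableT mS (measurable_cst _)).
exists (B1 `|` B2); split.
- exact: measurableU.
- have /le_trans := measureU2 P mB1 mB2; apply.
  rewrite mulr_natl mulr2n EFinD leeD//.
    exact: (chi2_upper_tail indX mgf).
  exact: (chi2_lower_tail indX mgf).
- move=> t /not_orP[/negP b1 /negP b2].
  have m0' : (0 < m%:R :> R)%R by rewrite ltr0n.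
  move: b1 b2; rewrite /B1 /B2 /= -!ltNge => b1 b2.
  rewrite mulrC ler_norml; apply/andP; split.
    rewrite lerBrDr ler_pdivlMr//; lra.
  rewrite lerBlDr ler_pdivrMr//; lra.
Qed.

End concentration.

(** * Concentration of the empirical covariance of Gaussian samples on finitely many vectors *)

Section gaussian_sample.
Context (R : realType) (dT : measure_display) (T : measurableType dT)
  (P : probability T R).
Local Open Scope classical_set_scope.
Local Open Scope ereal_scope.

Lemma measurable_lf (n : nat) (u : 'rV[R]_n) :
  measurable_fun [set: n.-tuple R] (lf u).
Proof.
apply: measurable_sum => k; apply: measurable_funM => //.
exact: measurable_tnth.
Qed.

HB.instance Definition _ (n : nat) (u : 'rV[R]_n) :=
  isMeasurableFun.Build _ _ (n.-tuple R) R (lf u) (measurable_lf u).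

Lemma bf_mulmx_tr (n : nat) (A : 'M[R]_n) (u : 'rV[R]_n) :
  bf (A *m A^T) u u = (\sum_l (u *m A) 0 l ^+ 2)%R.
Proof.
rewrite /bf mulmxA -(mulmxA _ A^T) -trmx_mul mxE.
by apply: eq_bigr => l _; rewrite [_^T _ _]mxE expr2.
Qed.

Lemma bf_mulmx_tr_gt0 (n : nat) (A : 'M[R]_n) (u : 'rV[R]_n) :
  A *m A^T \in unitmx -> (u != 0)%R -> (0 < bf (A *m A^T) u u)%R.
Proof.
rewrite unitmx_mul => /andP[uA _] u0; rewrite bf_mulmx_tr lt_def.
rewrite sumr_ge0 ?andbT; last by move=> l _; exact: sqr_ge0.
apply/eqP => /psumr_eq0P s0; move/eqP: u0; apply.
have vA : (u *m A = 0)%R.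
  apply/rowP => l; rewrite [RHS]mxE; apply/eqP; rewrite -sqrf_eq0; apply/eqP.
  by apply: s0 => // k _; exact: sqr_ge0.
by rewrite -(mulmxK uA u) vA mul0mx.
Qed.

Lemma gaussian_lf_mgf (n : nat) (Sigma : 'M[R]_n) (X : {RV P >-> n.-tuple R})
    (u : 'rV[R]_n) (r : R) :
  gaussian_vector P Sigma X ->
  \int[P]_t (expR (r * lf u (X t)))%:E = (expR (r ^+ 2 * bf Sigma u u / 2))%:E.
Proof.
move=> [A [Z [<- indZ lawZ XE]]].
rewrite bf_mulmx_tr -(lin_comb_mgf _ _ indZ lawZ).
apply: eq_integral => t _; congr (expR (_ * _))%:E.
rewrite /lf; under eq_bigr do rewrite XE mulr_sumr.
rewrite exchange_big/=; apply: eq_bigr => l _.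
by rewrite mxE mulr_suml; apply: eq_bigr => k _; rewrite mulrA.
Qed.

Lemma mutually_independent_slice (dS : measure_display) (S : measurableType dS)
    (I J : finType) (X : I -> J -> {RV P >-> S}) (b : I) :
  mutually_independent P (fun p : I * J => X p.1 p.2) ->
  mutually_independent P (X b).
Proof.
move=> indX B mB.
pose B' (p : I * J) := if p.1 == b then B p.2 else setT.
have mB' p : measurable (B' p) by rewrite /B'; case: ifP.
have := indX B' mB'.
have -> : \bigcap_(i in [set: I * J]) (X i.1 i.2 @^-1` B' i) =
    \bigcap_(i in [set: J]) (X b i @^-1` B i).
  apply/seteqP; split => t /= h.
    by move=> s _; have := h (b, s) Logic.I; rewrite /B'/= eqxx.
  by move=> [b' s] _; rewrite /B'/=; case: eqP => // ->; exact: h.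
move=> ->.
rewrite (eq_bigr (fun p => P (X (p.1, p.2).1 (p.1, p.2).2
  @^-1` B' (p.1, p.2)))); last by case.
rewrite -(pair_bigA _ (fun b' s => P (X b' s @^-1` B' (b', s))))/=.
rewrite (bigD1 b)//= [X in _ * X]big1 ?mule1.
  by apply: eq_bigr => s _; rewrite /B'/= eqxx.
move=> b' b'b; apply: big1 => s _; rewrite /B'/= (negbTE b'b) preimage_setT.
exact: probability_setT.
Qed.

Lemma union_bound (J : Type) (s : seq J) (B : J -> set T) :
  (forall j, measurable (B j)) ->
  P (\big[setU/set0]_(j <- s) B j) <= \sum_(j <- s) P (B j).
Proof.
move=> mB; elim: s => [|j s IH]; first by rewrite !big_nil measure0.
rewrite !big_cons.
have mU := @bigsetU_measurable _ _ _ s xpredT B (fun i _ => mB i).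
by have /le_trans := measureU2 P (mB j) mU; apply; rewrite leeD2l.
Qed.

Lemma emp_cov_concentration (n m : nat) (Sigma : 'M[R]_n) (K I : finType)
    (X : K -> 'I_m -> {RV P >-> n.-tuple R})
    (v : I -> 'rV[R]_n) (e : I -> R) :
  Sigma \in unitmx -> (0 < m)%N ->
  (forall b s, gaussian_vector P Sigma (X b s)) ->
  mutually_independent P (fun p : K * 'I_m => X p.1 p.2) ->
  (forall i, 0 < e i <= 1)%R ->
  exists B, [/\ measurable B,
    P B <= (\sum_i #|K|%:R * (2 * expR (- (m%:R * e i ^+ 2 / 2048))))%:E &
    forall t, ~ B t -> forall b i,
      (`|bf (emp_cov (fun s => X b s t)) (v i) (v i) - bf Sigma (v i) (v i)|
        <= e i * bf Sigma (v i) (v i))%R].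
Proof.
move=> uS m0 gX indX e01.
have h (p : I * K) : {B | measurable B /\
      P B <= (2 * expR (- (m%:R * e p.1 ^+ 2 / 2048)))%:E &
    forall t, ~ B t ->
      (`|bf (emp_cov (fun s => X p.2 s t)) (v p.1) (v p.1) - bf Sigma (v p.1) (v p.1)|
        <= e p.1 * bf Sigma (v p.1) (v p.1))%R}.
  case: p => i b /=; apply: cid2.
  have [A SE] : exists A : 'M[R]_n, A *m A^T = Sigma.
    by have [A [Z [SE _ _ _]]] := gX b (Ordinal m0); exists A.
  (* Signed atoms may cancel, so zero vectors do occur among the tests; the chi-square bound asks
     for a positive variance. *)
  have [v0|v0] := eqVneq (v i) 0%R.
    exists set0; first by split => //; rewrite measure0 lee_fin mulr_ge0 ?expR_ge0.
    by move=> t _; rewrite v0 !bf0l subr0 normr0 mulr0.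
  have q0 : (0 < bf Sigma (v i) (v i))%R.
    by rewrite -SE bf_mulmx_tr_gt0// SE.
  have [B [mB PB hB]] := chi2_tail (mutually_independent_slice b indX)
    (fun s r => gaussian_lf_mgf (v i) r (gX b s)) q0 (e01 i) m0.
  exists B => // t Bt; rewrite bf_emp_cov.
  by under eq_bigr do rewrite -expr2; exact: hB.
pose B p := s2val (h p).
have mB p : measurable (B p) by rewrite /B; case: (h p) => ? [].
exists (\big[setU/set0]_(p : I * K) B p); split.
- exact: bigsetU_measurable.
- have /le_trans := union_bound (index_enum (I * K)%type) mB; apply.
  apply: (@le_trans _ _ (\sum_(p : I * K) (2 * expR (- (m%:R * e p.1 ^+ 2 / 2048)))%:E)).
    by apply: lee_sum => p _; rewrite /B; case: (h p) => ? [].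
  rewrite sumEFin lee_fin -(pair_bigA _
    (fun i (b : K) => 2 * expR (- (m%:R * e i ^+ 2 / 2048))))%R/=.
  by apply: ler_sum => i _; rewrite sumr_const [leRHS]mulr_natl.
- move=> t Bt b i; have := s2valP' (h (i, b)) t; apply => Bib; apply: Bt.
  by rewrite -bigcup_seq; exists (i, b) => //=; rewrite mem_index_enum.
Qed.

End gaussian_sample.

(** * Precision matrices of SDD models *)

Definition evec (R : realType) (n : nat) (k : 'I_n) : 'rV[R]_n := delta_mx 0 k.
Arguments evec {R n} k.

Section precision.
Context (R : realType) (n : nat) (S : 'M[R]_n).
Hypothesis unitS : S \in unitmx.
Hypothesis symS : S^T = S.
Hypothesis pdS : forall u, u != 0 -> 0 < bf S u u.
Let Th := invmx S.
Implicit Types (u v : 'rV[R]_n) (i j k : 'I_n).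

Lemma bf_pd_ge0 u : 0 <= bf S u u.
Proof. by have [->|/pdS/ltW//] := eqVneq u 0; rewrite bf0l. Qed.

Lemma bf_evec k l : bf S (evec k) (evec l) = S k l.
Proof. by rewrite /bf /evec -rowE trmx_delta -colE !mxE. Qed.

Lemma evec_coord k l : (evec k : 'rV[R]_n) 0 l = (l == k)%:R.
Proof. by rewrite mxE eqxx. Qed.

Lemma evec_neq0 k : (evec k : 'rV[R]_n) != 0.
Proof.
apply/eqP => /rowP/(_ k); rewrite evec_coord eqxx mxE => /eqP.
by rewrite oner_eq0.
Qed.

Lemma cov_diag_gt0 k : 0 < S k k.
Proof. by rewrite -bf_evec pdS// evec_neq0. Qed.

Lemma bf_row_precision i v : bf S (row i Th) v = v 0 i.
Proof. by rewrite /bf -row_mul mulVmx// -row_mul mul1mx !mxE. Qed.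

Lemma precision_diag_gt0 i : 0 < Th i i.
Proof.
have := bf_row_precision i (row i Th); rewrite [in RHS]mxE => <-.
apply: pdS; apply/eqP => r0.
have := bf_row_precision i (evec i); rewrite r0 bf0l evec_coord eqxx => /eqP.
by rewrite eq_sym oner_eq0.
Qed.

Lemma precision_sym : Th^T = Th.
Proof. by rewrite /Th trmx_inv symS. Qed.

(* [xi i] represents the error of the regression of X_i on all the other
   variables, whose variance is [(Th i i)^-1]. *)
Definition xi i : 'rV[R]_n := (Th i i)^-1 *: row i Th.

Lemma bf_xi i v : bf S (xi i) v = (Th i i)^-1 * v 0 i.
Proof. by rewrite bfZl bf_row_precision. Qed.

Lemma xi_coord i k : xi i 0 k = Th i k / Th i i.
Proof. by rewrite !mxE mulrC. Qed.

Lemma bf_xixi i : bf S (xi i) (xi i) = (Th i i)^-1.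
Proof.
by rewrite bf_xi xi_coord divff ?mulr1// gt_eqF// precision_diag_gt0.
Qed.

(** Cauchy-Schwarz against [xi i]. This turns a bound on the excess variance into bounds on the
    errors of single coefficients. *)
Lemma coord_sq_le i v : v 0 i ^+ 2 / Th i i <= bf S v v.
Proof.
have := bf_CS symS bf_pd_ge0 (xi i) v; rewrite bf_xixi bf_xi.
have t0 := precision_diag_gt0 i.
have -> : ((Th i i)^-1 * v 0 i) ^+ 2 = (Th i i)^-1 * (v 0 i ^+ 2 / Th i i) by ring.
by rewrite ler_pM2l ?invr_gt0.
Qed.

Definition res j k : 'rV[R]_n := evec k - (S k j / S j j) *: evec j.

(* [cvar j k] is the variance of X_k given X_j. *)
Definition cvar j k : R := bf S (res j k) (res j k).

Lemma bf_res j k : bf S (res j k) (evec j) = 0.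
Proof.
rewrite bfDl bfNl bfZl !bf_evec divfK ?subrr//.
by rewrite gt_eqF// cov_diag_gt0.
Qed.

Lemma bf_res_shift j k b :
  bf S (evec k - b *: evec j) (evec k - b *: evec j) =
  cvar j k + (S k j / S j j - b) ^+ 2 * S j j.
Proof.
have -> : evec k - b *: evec j = res j k + (S k j / S j j - b) *: evec j.
  by rewrite /res scalerBl addrA subrK.
by rewrite (bf_sqD symS) !bfZr !bfZl bf_res bf_evec /cvar; ring.
Qed.

Lemma cvar_le j k b : cvar j k <= bf S (evec k - b *: evec j) (evec k - b *: evec j).
Proof.
by rewrite bf_res_shift lerDl mulr_ge0 ?sqr_ge0// ltW// cov_diag_gt0.
Qed.

Lemma cvar_le_var j k : cvar j k <= S k k.
Proof. by have := cvar_le j k 0; rewrite scale0r subr0 bf_evec. Qed.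

Lemma cvar_gt0 j k : k != j -> 0 < cvar j k.
Proof.
move=> kj; apply: pdS; apply/eqP => /rowP/(_ k).
rewrite !mxE !eqxx (negbTE kj) mulr0 subr0 => /eqP.
by rewrite oner_eq0.
Qed.

Lemma cvar_ge j i : i != j -> (Th i i)^-1 <= cvar j i.
Proof.
move=> ij; have := coord_sq_le i (res j i).
by rewrite !mxE !eqxx (negbTE ij) mulr0 subr0 expr1n mul1r.
Qed.

(* [rvec j k] is the normalized residual of X_k given X_j, and [rvec j j] is
   the normalized X_j. *)
Definition rscale j k : R := if k == j then Num.sqrt (S j j) else Num.sqrt (cvar j k).

Definition rvec j k : 'rV[R]_n :=
  (rscale j k)^-1 *: (if k == j then evec j else res j k).

Lemma rscale_gt0 j k : 0 < rscale j k.
Proof.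
rewrite /rscale; case: eqP => [_|/eqP kj]; rewrite sqrtr_gt0.
  exact: cov_diag_gt0.
exact: cvar_gt0.
Qed.

Lemma rscale_neq j k : k != j -> rscale j k = Num.sqrt (cvar j k).
Proof. by rewrite /rscale => /negbTE ->. Qed.

Lemma bf_rvec j k : bf S (rvec j k) (rvec j k) = 1.
Proof.
rewrite bfZl bfZr mulrA -expr2 exprVn.
have := rscale_gt0 j k; rewrite /rscale; case: eqP => [_|/eqP kj] s0.
  by rewrite bf_evec sqr_sqrtr ?mulVf ?gt_eqF ?ltW ?cov_diag_gt0.
by rewrite sqr_sqrtr ?mulVf ?gt_eqF ?ltW ?cvar_gt0.
Qed.

Lemma bf_rvecjj j k : k != j -> bf S (rvec j k) (rvec j j) = 0.
Proof. by move=> kj; rewrite bfZl bfZr eqxx (negbTE kj) bf_res !mulr0. Qed.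

(** Through [bf_xi] this makes the residual [xi i] uncorrelated with every normalized regressor. *)
Lemma rvec_coord0 j k i : j != i -> k != i -> rvec j k 0 i = 0.
Proof.
move=> ji ki; rewrite /rvec; case: eqP => _.
  by rewrite !mxE eqxx eq_sym (negbTE ji) mulr0.
by rewrite !mxE eqxx ![i == _]eq_sym (negbTE ji) (negbTE ki) mulr0 subrr mulr0.
Qed.

Lemma evec_rvec j k : evec k = rscale j k *: rvec j k +
  (if k == j then 0 else (S k j / S j j) * Num.sqrt (S j j)) *: rvec j j.
Proof.
have s0 k' : rscale j k' != 0 by rewrite gt_eqF ?rscale_gt0.
case: (eqVneq k j) => [->|kj].
  by rewrite scale0r addr0 /rvec eqxx scalerA mulfV ?scale1r.
rewrite /rvec eqxx (negbTE kj) !scalerA mulfV// scale1r.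
have -> : Num.sqrt (S j j) = rscale j j by rewrite /rscale eqxx.
by rewrite mulfK// subrK.
Qed.

(** All contributions along X_j gather in the one number [b]. It can stay unspecified, since the l1
    constraint does not involve it. *)
Lemma sum_evec_rvec i j (c : 'I_n -> R) : j != i ->
  exists b, \sum_(k < n | k != i) c k *: evec k =
    \sum_(k < n | (k != i) && (k != j)) (c k * rscale j k) *: rvec j k +
    b *: rvec j j.
Proof.
move=> ji.
pose s k := if k == j then 0 else (S k j / S j j) * Num.sqrt (S j j).
exists (c j * rscale j j + \sum_(k < n | k != i) c k * s k).
rewrite scalerDl addrA scaler_suml.
have -> : \sum_(k < n | (k != i) && (k != j)) (c k * rscale j k) *: rvec j k +
    (c j * rscale j j) *: rvec j j = \sum_(k < n | k != i) (c k * rscale j k) *: rvec j k.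
  by rewrite [RHS](bigD1 j)//= addrC.
rewrite -big_split/=; apply: eq_bigr => k _.
by rewrite [in LHS](evec_rvec j k) scalerDr !scalerA.
Qed.

End precision.

(** * Consequences of diagonal dominance *)

Section sdd.
Context (R : realType) (n : nat) (S : 'M[R]_n).
Hypothesis unitS : S \in unitmx.
Hypothesis symS : S^T = S.
Hypothesis pdS : forall u, u != 0 -> 0 < bf S u u.
Let Th := invmx S.
Hypothesis sddTh : SDD Th.
Implicit Types (u v x : 'rV[R]_n) (i j k l : 'I_n).

(** The form of S at v is the supremum of (x v^T)^2 over the form of [Th] at x, attained at
    [x = v *m S], where the hypothesis is used. *)
Lemma dual_bound (c : R) v :
  (forall x, c * ((x *m v^T) 0 0) ^+ 2 <= bf Th x x) -> c * bf S v v <= 1.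
Proof.
move=> h; have := h (v *m S).
have -> : bf Th (v *m S) (v *m S) = bf S v v.
  by rewrite /bf trmx_mul symS -!mulmxA (mulmxA S Th) mulmxV// mul1mx.
rewrite -/(bf S v v).
have [->|v0] := eqVneq v 0; first by rewrite !bf0l mulr0.
by rewrite expr2 mulrA -ler_pdivlMr ?pdS// divff// gt_eqF ?pdS.
Qed.

Let sgn i k : R := Num.sg (Th i k).

Let slack i := Th i i - \sum_(j < n | j != i) `|Th i j|.

Let T x k l := `|Th k l| * (x 0 k + sgn k l * x 0 l) ^+ 2.

Let symTh k l : Th k l = Th l k.
Proof. by have /matrixP/(_ l k) := precision_sym symS; rewrite mxE. Qed.

Let TE x k l : T x k l =
  `|Th k l| * x 0 k ^+ 2 + `|Th k l| * x 0 l ^+ 2 + 2 * (x 0 k * Th k l * x 0 l).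
Proof.
rewrite /T /sgn; case: (ltgtP (Th k l) 0) => [h|h|->].
- by rewrite ltr0_sg// ltr0_norm//; ring.
- by rewrite gtr0_sg// gtr0_norm//; ring.
- by rewrite normr0 !mul0r mulr0 mul0r; ring.
Qed.

(** In [T x k l] the sign makes the cross term 2 x_k [Th k l] x_l. By symmetry the squares add up to
    row sums of absolute values, which [slack] removes from the diagonal; the factor 1/2 is there
    because each pair is met twice. *)
Lemma precision_form x : bf Th x x =
  \sum_k slack k * x 0 k ^+ 2 + 2^-1 * \sum_k \sum_(l < n | l != k) T x k l.
Proof.
pose A k := \sum_(l < n | l != k) `|Th k l| * x 0 k ^+ 2.
pose B k := \sum_(l < n | l != k) `|Th k l| * x 0 l ^+ 2.
pose D k := \sum_(l < n | l != k) x 0 k * Th k l * x 0 l.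
have TS k : \sum_(l < n | l != k) T x k l = A k + B k + 2 * D k.
  rewrite /A /B /D mulr_sumr -!big_split/=.
  by apply: eq_bigr => l _; rewrite TE.
have AB : \sum_k B k = \sum_k A k.
  rewrite /B (exchange_big_dep predT)//=; apply: eq_bigr => l _.
  rewrite /A; apply: eq_big => [k|k _]; first by rewrite eq_sym.
  by rewrite symTh.
rewrite [X in 2^-1 * X](eq_bigr _ (fun k _ => TS k)).
rewrite !big_split/= AB -mulr_sumr bfE.
have -> : \sum_k \sum_l x 0 k * Th k l * x 0 l = \sum_k Th k k * x 0 k ^+ 2 + \sum_k D k.
  rewrite -big_split/=; apply: eq_bigr => k _.
  rewrite (bigD1 k)//=; congr (_ + _); ring.
have -> : \sum_k slack k * x 0 k ^+ 2 = \sum_k Th k k * x 0 k ^+ 2 - \sum_k A k.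
  rewrite -sumrB; apply: eq_bigr => k _.
  by rewrite /slack /A mulrBl mulr_suml.
by field.
Qed.

Let slack_ge0 k : 0 <= slack k.
Proof. by rewrite subr_ge0; exact: sddTh. Qed.

Let T_ge0 x k l : 0 <= T x k l.
Proof. by rewrite mulr_ge0 ?sqr_ge0. Qed.

(** All terms of the decomposition are nonnegative, and the edge occurs in it both as (i, k) and as
    (k, i), which offsets the factor 1/2. *)
Lemma precision_form_ge_edge x i k : i != k -> T x i k <= bf Th x x.
Proof.
move=> ik.
have Tki : T x k i = T x i k by rewrite !TE symTh; ring.
rewrite precision_form.
apply: (@le_trans _ _ (2^-1 * (T x i k + T x k i))); first by rewrite Tki; lra.
rewrite -[leLHS]add0r lerD ?sumr_ge0// => [l _|]; first by rewrite mulr_ge0 ?sqr_ge0.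
rewrite ler_wpM2l ?invr_ge0// (bigD1 i)//= lerD//.
  rewrite (bigD1 k) 1?eq_sym//= lerDl sumr_ge0//.
rewrite (bigD1 k) 1?eq_sym//= (bigD1 i)//=.
rewrite -addrA lerDl addr_ge0 ?sumr_ge0// => l _; rewrite sumr_ge0//.
Qed.

Lemma precision_form_ge_slack x i : slack i * x 0 i ^+ 2 <= bf Th x x.
Proof.
rewrite precision_form (bigD1 i)//= -addrA lerDl addr_ge0//.
  by rewrite sumr_ge0// => l _; rewrite mulr_ge0 ?sqr_ge0.
by rewrite mulr_ge0 ?invr_ge0// sumr_ge0// => k _; rewrite sumr_ge0.
Qed.

Let evecE x k : (x *m (evec k)^T) 0 0 = x 0 k.
Proof. by rewrite /evec trmx_delta -colE mxE. Qed.

Lemma edge_var_le i k : i != k ->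
  `|Th i k| * bf S (evec i + sgn i k *: evec k) (evec i + sgn i k *: evec k) <= 1.
Proof.
move=> ik; apply: dual_bound => x.
rewrite linearD linearZ mulmxDr -scalemxAr mxE [X in _ + X]mxE !evecE.
exact: precision_form_ge_edge.
Qed.

Lemma slack_var_le i : slack i * S i i <= 1.
Proof.
rewrite -bf_evec; apply: dual_bound => x; rewrite evecE.
exact: precision_form_ge_slack.
Qed.

(** Either some entry satisfies |[Th i j]| >= [Th i i] / (2 d), and X_i is well predicted by -sgn
    X_j; or the at most d entries of the row sum to at most half the diagonal, so that the slack
    alone bounds the variance of X_i and any j serves. *)
Lemma exists_good_conditioner d i : (1 <= d)%N -> (1 < n)%N ->
  (#|[set j | ggm_adjacent Th i j]%SET| <= d)%N ->
  exists2 j, j != i & cvar S j i <= 2 * d%:R * (Th i i)^-1.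
Proof.
move=> d1 n1 degi.
have t0 := precision_diag_gt0 unitS pdS i; rewrite -/Th in t0.
have d1' : 1 <= d%:R :> R by rewrite ler1n.
have d0 : 0 < d%:R :> R by lra.
have [[j ji jbig]|small] := pselect (exists2 j, j != i & Th i i / (2 * d%:R) <= `|Th i j|).
  exists j => //.
  have ij : i != j by rewrite eq_sym.
  have a0 : 0 < `|Th i j| by apply: lt_le_trans jbig; rewrite divr_gt0 ?mulr_gt0.
  have := edge_var_le ij.
  have := cvar_le symS pdS j i (- sgn i j).
  have -> : evec i - - sgn i j *: evec j = evec i + sgn i j *: evec j.
    by rewrite scaleNr opprK.
  set Q := bf S _ _ => cQ Q1.
  apply: le_trans cQ _.
  have Q2 : Q <= `|Th i j|^-1 by rewrite -[leRHS]mul1r ler_pdivlMr// mulrC.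
  apply: le_trans Q2 _.
  rewrite -[leRHS]invrK lef_pV2 ?posrE ?invr_gt0 ?mulr_gt0 ?invr_gt0//.
  by rewrite invfM invrK mulrC.
have [j ji] : exists j, j != i.
  case: (eqVneq i (Ordinal (ltnW n1))) => [->|h]; last first.
    by exists (Ordinal (ltnW n1)); rewrite eq_sym.
  by exists (Ordinal n1).
exists j => //.
apply: le_trans (cvar_le_var symS pdS j i) _.
have le_sum : \sum_(k < n | k != i) `|Th i k| <= Th i i / 2.
  apply: (@le_trans _ _ (\sum_(k in [set j | ggm_adjacent Th i j]%SET)
      Th i i / (2 * d%:R))).
    rewrite (bigID (fun k => Th i k != 0))/= [X in _ + X]big1 ?addr0; last first.
      by move=> k /andP[_]; rewrite negbK => /eqP ->; rewrite normr0.
    rewrite [leRHS](eq_bigl (fun k => (k != i) && (Th i k != 0))); last first.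
      by move=> k; rewrite inE /ggm_adjacent eq_sym.
    apply: ler_sum => k /andP[ki _]; rewrite leNgt; apply/negP => /ltW h.
    by apply: small; exists k.
  rewrite sumr_const -[leLHS]mulr_natr.
  apply: (@le_trans _ _ (Th i i / (2 * d%:R) * d%:R)).
    by rewrite ler_wpM2l ?ler_nat// divr_ge0 ?mulr_ge0// ltW.
  have -> : Th i i / (2 * d%:R) * d%:R = Th i i / 2 by field; rewrite gt_eqF.
  by [].
have sl : Th i i / 2 <= slack i by rewrite /slack; lra.
have := slack_var_le i.
have s0 : 0 <= S i i by rewrite ltW// cov_diag_gt0.
move=> s1.
have : Th i i / 2 * S i i <= 1 by apply: le_trans s1; rewrite ler_wpM2r.
rewrite ler_pdivlMr//.
have : 0 <= Th i i * S i i by rewrite mulr_ge0// ltW.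
nra.
Qed.

(** Up to sign X_k is the difference of X_i + sgn X_k, of variance at most 1 / |[Th i k]|, and of
    X_i. The triangle inequality for residuals given X_j therefore bounds each term by sqrt
    |[Th i k]| plus |[Th i k]| times the deviation of X_i given X_j, up to the factor 1 / [Th i i].
    Diagonal dominance sums the second kind, and sparsity with AM-GM the first. *)
Lemma true_l1_le d i j : j != i -> (1 <= d)%N ->
  (#|[set j | ggm_adjacent Th i j]%SET| <= d)%N ->
  \sum_(k < n | (k != i) && (k != j)) `|Th i k| / Th i i * Num.sqrt (cvar S j k)
   <= Num.sqrt (d%:R * (Th i i)^-1) + Num.sqrt (cvar S j i).
Proof.
move=> ji d1 degi.
have t0 := precision_diag_gt0 unitS pdS i; rewrite -/Th in t0.
have d0 : 0 < d%:R :> R by rewrite ltr0n.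
set V := Num.sqrt (cvar S j i).
have V0 : 0 <= V by exact: sqrtr_ge0.
have psdS := bf_pd_ge0 pdS.
have sq k : k != i ->
    `|Th i k| * Num.sqrt (cvar S j k) <= Num.sqrt `|Th i k| + `|Th i k| * V.
  move=> ki; have [->|T0] := eqVneq (Th i k) 0.
    by rewrite normr0 !mul0r sqrtr0 addr0.
  have a0 : 0 < `|Th i k| by rewrite normr_gt0.
  have ik : i != k by rewrite eq_sym.
  have sg2 : sgn i k * sgn i k = 1 by rewrite -expr2 /sgn sqr_sg T0.
  have h1 : cvar S j k <= bf S
      (sgn i k *: (evec i + sgn i k *: evec k) + (- sgn i k) *: res S j i)
      (sgn i k *: (evec i + sgn i k *: evec k) + (- sgn i k) *: res S j i).
    (* This is X_k minus a multiple of X_j, since [sgn i k] squares to 1; [cvar_le] allows any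
       multiple. *)
    have -> : sgn i k *: (evec i + sgn i k *: evec k) + (- sgn i k) *: res S j i
       = evec k - (- sgn i k * (S i j / S j j)) *: evec j.
      rewrite /res scalerDr scalerA sg2 scale1r scalerBr !scalerA !scaleNr !mulNr scaleNr !opprK.
      by rewrite addrACA subrr add0r.
    exact: cvar_le.
  have h2 : Num.sqrt (cvar S j k) <= Num.sqrt (bf S (evec i + sgn i k *: evec k)
      (evec i + sgn i k *: evec k)) + V.
    apply: le_trans (ler_wsqrtr h1) _; apply: le_trans (bf_triangle symS psdS _ _) _.
    rewrite !bfZl !bfZr !mulrA mulrNN sg2 !mul1r -/(cvar S j i).
    by rewrite lexx.
  have h3 := edge_var_le ik.
  set Q := bf S _ _ in h2 h3.
  apply: le_trans (ler_wpM2l (ltW a0) h2) _; rewrite mulrDr lerD2r.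
  rewrite -[X in X * _ <= _](sqr_sqrtr (ltW a0)) expr2 -mulrA -(sqrtrM _ (ltW a0)).
  by rewrite -[leRHS]mulr1 ler_wpM2l ?sqrtr_ge0// -sqrtr1 ler_wsqrtr.
(* AM-GM: [sqrt a <= (a / c + c) / 2] with [c = sqrt (Th i i / d)]. *)
pose c := Num.sqrt (Th i i / d%:R).
have c0 : 0 < c by rewrite sqrtr_gt0 divr_gt0.
have c2 : c ^+ 2 = Th i i / d%:R by rewrite sqr_sqrtr// divr_ge0// ltW.
have amgm a : 0 <= a -> Num.sqrt a <= 2^-1 * (a / c + c).
  move=> a0; move: (sqr_sqrtr a0); set r := Num.sqrt a => <-.
  have : 0 <= (r - c) ^+ 2 / c by rewrite divr_ge0 ?sqr_ge0// ltW.
  have -> : (r - c) ^+ 2 / c = r ^+ 2 / c + c - 2 * r by field; rewrite gt_eqF.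
  lra.
have sumT : \sum_(k < n | (k != i) && (k != j)) `|Th i k| <= Th i i.
  apply: le_trans (sddTh i); rewrite [leRHS](bigD1 j)//= addrC lerDl.
  exact: normr_ge0.
have sumsq : \sum_(k < n | (k != i) && (k != j)) Num.sqrt `|Th i k| <=
    Num.sqrt (d%:R * Th i i).
  apply: (@le_trans _ _
    (\sum_(k < n | ((k != i) && (k != j)) && (Th i k != 0))
      2^-1 * (`|Th i k| / c + c))).
    rewrite (bigID (fun k => Th i k != 0))/= [X in _ + X]big1 ?addr0; last first.
      by move=> k /andP[_]; rewrite negbK => /eqP ->; rewrite normr0 sqrtr0.
    by apply: ler_sum => k _; exact: amgm.
  rewrite -mulr_sumr big_split/= -mulr_suml sumr_const.
  have cN : c *+ #|[pred k : 'I_n |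
      ((k != i) && (k != j)) && (Th i k != 0)]| <= d%:R * c.
    rewrite -[leLHS]mulr_natl ler_wpM2r ?(ltW c0)// ler_nat.
    apply: leq_trans degi; apply: subset_leq_card; apply/fintype.subsetP => k.
    by rewrite !inE /ggm_adjacent => /andP[/andP[ki _] ->]; rewrite eq_sym ki.
  have sT : (\sum_(k < n | ((k != i) && (k != j)) && (Th i k != 0)) `|Th i k|)
      / c <= Th i i / c.
    rewrite ler_pM2r ?invr_gt0//; apply: le_trans sumT.
    rewrite [leRHS](bigID (fun k => Th i k != 0))/= lerDl sumr_ge0//.
  have -> : Num.sqrt (d%:R * Th i i) = d%:R * c.
    rewrite -[RHS]ger0_norm ?mulr_ge0 ?(ltW d0) ?(ltW c0)// -sqrtr_sqr exprMn c2.
    by congr Num.sqrt; field; rewrite gt_eqF.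
  have Tc : Th i i / c = d%:R * c.
    have -> : Th i i = d%:R * c ^+ 2 by rewrite c2; field; rewrite gt_eqF.
    by field; rewrite gt_eqF.
  rewrite Tc in sT; lra.
apply: (@le_trans _ _ (\sum_(k < n | (k != i) && (k != j)) (Th i i)^-1 *
    (Num.sqrt `|Th i k| + `|Th i k| * V))).
  apply: ler_sum => k /andP[ki _].
  by rewrite mulrAC mulrC ler_wpM2l ?invr_ge0 ?(ltW t0)// sq.
rewrite -mulr_sumr big_split/= -mulr_suml mulrDr lerD//.
  have -> : Num.sqrt (d%:R * (Th i i)^-1) = (Th i i)^-1 * Num.sqrt (d%:R * Th i i).
    have i0 : 0 <= (Th i i)^-1 by rewrite invr_ge0 ltW.
    rewrite -[RHS](ger0_norm (mulr_ge0 i0 (sqrtr_ge0 _))) -sqrtr_sqr exprMn.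
    rewrite sqr_sqrtr ?mulr_ge0 ?(ltW t0)//.
    by congr Num.sqrt; field; rewrite gt_eqF.
  by rewrite ler_wpM2l// invr_ge0 ltW.
rewrite mulrA -[leRHS]mul1r ler_wpM2r// mulrC ler_pdivrMr// mul1r//.
Qed.

End sdd.

(** * Sparsification *)

Section sparsification.
Context (R : realType) (n : nat) (D : 'M[R]_n) (I : finType).
Hypothesis symD : D^T = D.

Lemma exists_le_average (p phi : I -> R) :
  (forall i, 0 <= p i) -> \sum_i p i = 1 ->
  exists i, phi i <= \sum_i p i * phi i.
Proof.
move=> p0 p1; apply/not_existsP => h.
have {}h i : \sum_i p i * phi i < phi i by rewrite ltNge; apply/negP; exact: h.
set M := \sum_i _ in h.
have : \sum_i (p i * phi i - M * p i) <= 0.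
  by rewrite sumrB subr_le0 -mulr_sumr p1 mulr1.
have ge0 i : 0 <= p i * phi i - M * p i.
  by rewrite mulrC -mulrBl mulr_ge0// subr_ge0 ltW.
move=> le0; have : \sum_i (p i * phi i - M * p i) = 0.
  by apply/eqP; rewrite eq_le le0 sumr_ge0.
move/psumr_eq0P => /(_ (fun i _ => ge0 i)) z.
have pz i : p i = 0.
  have /eqP := z i isT; rewrite mulrC -mulrBl mulf_eq0 => /orP[|/eqP//].
  by rewrite subr_eq0 => /eqP e; have := h i; rewrite e ltxx.
move: p1; rewrite big1 => [|i _]; last exact: pz.
by move/eqP; rewrite eq_sym oner_eq0.
Qed.

(* Maurey's empirical method: replacing each of [N] steps in the mean
   direction by a well-chosen atom does not raise the form above its average
   over independent random atoms. *)
Lemma maurey (p : I -> R) (a : I -> 'rV[R]_n) (N : nat) (h : 'rV[R]_n) :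
  (forall i, 0 <= p i) -> \sum_i p i = 1 ->
  let v := \sum_i p i *: a i in
  exists U : N.-tuple I,
  bf D (h + \sum_(i <- U) a i) (h + \sum_(i <- U) a i) <=
  bf D h h + 2 * N%:R * bf D h v + N%:R * (\sum_i p i * bf D (a i) (a i)) +
  N%:R * (N%:R - 1) * bf D v v.
Proof.
move=> p0 p1 v; elim: N h => [|N IH] h.
  by exists [tuple]; rewrite big_nil addr0; lra.
(* The part of the induction bound started at [h + a i] that depends on the first atom. *)
pose phi i := bf D (h + a i) (h + a i) + 2 * N%:R * bf D (h + a i) v.
have [i phii] := exists_le_average phi p0 p1.
have [U hU] := IH (h + a i).
exists [tuple of i :: U]; rewrite big_cons addrA; apply: le_trans hU _.
have avg : \sum_i p i * phi i = bf D h h + 2 * bf D h v +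
    \sum_i p i * bf D (a i) (a i) + 2 * N%:R * (bf D h v + bf D v v).
  have hv : bf D h v = \sum_i p i * bf D h (a i).
    by rewrite bf_sumr; apply: eq_bigr => k _; rewrite bfZr.
  have vv : bf D v v = \sum_i p i * bf D (a i) v.
    by rewrite {1}/v bf_suml; apply: eq_bigr => k _; rewrite bfZl.
  have -> : bf D h h = \sum_i p i * bf D h h by rewrite -mulr_suml p1 mul1r.
  rewrite [X in 2 * _ * (X + _)](_ : _ = \sum_i p i * bf D h v); last first.
    by rewrite -mulr_suml p1 mul1r.
  rewrite hv vv -big_split/= !mulr_sumr -!big_split/=; apply: eq_bigr => k _.
  by rewrite /phi (bf_sqD symD) bfDl -hv; ring.
rewrite avg /phi in phii.
rewrite -natr1; set w := N%:R in phii *; lra.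
Qed.

(** [D] need not be positive semidefinite. Write w for the combination of the [r i] and L for its l1
    norm. Some sum of N atoms +-(L/N) [r i], shifted by h = [b *: z], has a form at most D(h + w) -
    D(w)/N + L^2 M/N, so the latter is nonnegative. The case h = 0 gives D(w) >= - L^2 M/(N - 1),
    and 1/N + 1/(N (N - 1)) = 1/(N - 1). *)
Lemma sparse_lower_bound (r : I -> 'rV[R]_n) (z : 'rV[R]_n) (N : nat) (M : R)
    (c : I -> R) (b : R) (i0 : I) :
  (1 < N)%N ->
  (forall (U : N.-tuple (I * bool)) (x y : R),
    0 <= bf D (x *: (\sum_(i <- U) (-1) ^+ i.2 *: r i.1) + y *: z)
              (x *: (\sum_(i <- U) (-1) ^+ i.2 *: r i.1) + y *: z)) ->
  (forall i, bf D (r i) (r i) <= M) ->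
  0 <= M ->
  - ((\sum_i `|c i|) ^+ 2 * M / (N%:R - 1)) <=
  bf D (\sum_i c i *: r i + b *: z) (\sum_i c i *: r i + b *: z).
Proof.
move=> N1 hU rM M0.
have N1' : 0 < N%:R - 1 :> R by rewrite subr_gt0 ltr1n.
have N0 : 0 < N%:R :> R by lra.
set L := \sum_i `|c i|.
have L0 : 0 <= L by apply: sumr_ge0.
have [LE|Lneq] := eqVneq L 0.
  have c0 i : c i = 0.
    by apply/eqP; rewrite -normr_eq0; apply/eqP; apply: (psumr_eq0P _ LE).
  rewrite LE expr0n/= !mul0r oppr0 big1 ?add0r; last first.
    by move=> i _; rewrite c0 scale0r.
  (* With x = 0 any tuple will do; [i0] supplies one. *)
  by have := hU [tuple of nseq N (i0, false)] 0 b; rewrite scale0r add0r.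
have Lgt : 0 < L by rewrite lt_def Lneq.
pose p i := `|c i| / L.
pose sg i := c i < 0.
pose a i := (L / N%:R) *: ((-1) ^+ sg i *: r i).
have p0 i : 0 <= p i by rewrite divr_ge0.
have p1 : \sum_i p i = 1 by rewrite -mulr_suml divff.
set w := \sum_i c i *: r i.
have pa : \sum_i p i *: a i = N%:R^-1 *: w.
  rewrite scaler_sumr; apply: eq_bigr => i _.
  rewrite !scalerA; congr (_ *: _).
  have -> : (-1) ^+ sg i = (-1) ^+ (c i < 0)%R :> R by [].
  rewrite {2}[c i]realEsign ?num_real// /p; field.
  by rewrite !gt_eqF.
have m2 : \sum_i p i * bf D (a i) (a i) <= (L / N%:R) ^+ 2 * M.
  apply: (@le_trans _ _ (\sum_i p i * ((L / N%:R) ^+ 2 * M))); last first.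
    by rewrite -mulr_suml p1 mul1r.
  apply: ler_sum => i _; rewrite ler_wpM2l//.
  have s2 : (-1) ^+ sg i * ((-1) ^+ sg i) = 1 :> R by rewrite -expr2 sqrr_sign.
  have -> : bf D (a i) (a i) =
      (L / N%:R) ^+ 2 * ((-1) ^+ sg i * ((-1) ^+ sg i)) * bf D (r i) (r i).
    by rewrite /a !bfZl !bfZr; ring.
  by rewrite s2 mulr1 ler_wpM2l ?sqr_ge0.
have key h : (exists y, h = y *: z) -> 0 <= bf D h h + 2 * bf D h w +
    L ^+ 2 * M / N%:R + (1 - N%:R^-1) * bf D w w.
  move=> [y hy].
  have [U] := maurey a N h p0 p1; rewrite pa => hmau.
  have pos : 0 <= bf D (h + \sum_(i <- U) a i) (h + \sum_(i <- U) a i).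
    have := hU [tuple of map (fun i => (i, sg i)) U] (L / N%:R) y.
    by rewrite big_map/= scaler_sumr -hy addrC.
  have := le_trans pos hmau; rewrite !bfZr !bfZl => /le_trans; apply.
  have -> : 2 * N%:R * (N%:R^-1 * bf D h w) = 2 * bf D h w by field; rewrite gt_eqF.
  have -> : N%:R * (N%:R - 1) * (N%:R^-1 * (N%:R^-1 * bf D w w)) =
    (1 - N%:R^-1) * bf D w w by field; rewrite gt_eqF.
  have -> : L ^+ 2 * M / N%:R = N%:R * ((L / N%:R) ^+ 2 * M) by field; rewrite gt_eqF.
  by rewrite lerD2r lerD2l ler_pM2l.
have k1 := key (b *: z) (ex_intro _ b erefl).
have k0 := key 0 (ex_intro _ 0 (esym (scale0r z))).
rewrite !bf0l mulr0 !add0r in k0.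
rewrite (bf_sqD symD) (bfC symD w) [leRHS]addrC [X in X <= _](_ : _ =
  - (L ^+ 2 * M / N%:R) - N%:R^-1 * (L ^+ 2 * M / (N%:R - 1))); last first.
  by field; rewrite !gt_eqF.
have ww : - (L ^+ 2 * M / (N%:R - 1)) <= bf D w w.
  have : 0 <= (N%:R / (N%:R - 1)) * (L ^+ 2 * M / N%:R + (1 - N%:R^-1) * bf D w w).
    by rewrite mulr_ge0// divr_ge0 ?ltW.
  have -> : (N%:R / (N%:R - 1)) * (L ^+ 2 * M / N%:R + (1 - N%:R^-1) * bf D w w) =
    L ^+ 2 * M / (N%:R - 1) + bf D w w by field; rewrite !gt_eqF.
  lra.
have : - (N%:R^-1 * (L ^+ 2 * M / (N%:R - 1))) <= N%:R^-1 * bf D w w.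
  by rewrite -mulrN; apply: ler_wpM2l => //; rewrite invr_ge0 ltW.
lra.
Qed.

End sparsification.

(** * The good event and its extension from finitely many tests to all combinations *)

Definition close_at (R : realType) (n : nat) (S M : 'M[R]_n) (e : R)
    (w : 'rV[R]_n) : Prop :=
  `|bf M w w - bf S w w| <= e * bf S w w.

(* By polarization, accuracy on these four vectors gives accuracy on the plane
   spanned by [u] and [v] when these are orthogonal. *)
Definition pair_test (R : realType) (n : nat) (S : 'M[R]_n) (u v : 'rV[R]_n)
    (q : 'I_4) : 'rV[R]_n :=
  let a := Num.sqrt (bf S u u) in let b := Num.sqrt (bf S v v) in
  nth 0 [:: u; v; b *: u + a *: v; b *: u - a *: v] q.

(* The atom of index [j] itself is [0], so that every combination of atoms is
   orthogonal to [rvec S j j], whose coefficient is unbounded. *)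
Definition atom (R : realType) (n : nat) (S : 'M[R]_n) (j k : 'I_n) : 'rV[R]_n :=
  if k == j then 0 else rvec S j k.

Definition sparse_comb (R : realType) (n : nat) (S : 'M[R]_n) (j : 'I_n)
    (N : nat) (U : N.-tuple ('I_n * bool)) : 'rV[R]_n :=
  \sum_(i <- U) (-1) ^+ i.2 *: atom S j i.1.

(** [e] is the constant accuracy for sums of [N] signed atoms, [e0] the finer one for the
    correlations of the residuals with the regressors. *)
Definition good_sample (R : realType) (n : nat) (S M : 'M[R]_n) (e e0 : R)
    (N : nat) : Prop :=
  (forall j (U : N.-tuple ('I_n * bool)) q,
     close_at S M e (pair_test S (sparse_comb S j U) (rvec S j j) q)) /\
  (forall i j k q, close_at S M e0 (pair_test S (xi S i) (rvec S j k) q)).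

Section good_sample.
Context (R : realType) (n : nat) (S M : 'M[R]_n) (e e0 : R) (N : nat).
Hypothesis unitS : S \in unitmx.
Hypothesis symS : S^T = S.
Hypothesis pdS : forall u, u != 0 -> 0 < bf S u u.
Hypothesis symM : M^T = M.
Hypothesis e_ge0 : 0 <= e.
Hypothesis N_gt1 : (1 < N)%N.
Let Th := invmx S.
Let psdS := bf_pd_ge0 pdS.

Lemma bf_mx_lin (A B : 'M[R]_n) (a b : R) u v :
  bf (a *: A + b *: B) u v = a * bf A u v + b * bf B u v.
Proof. by rewrite /bf mulmxDr mulmxDl -!scalemxAr -!scalemxAl !mxE. Qed.

(** The weights in b u + a v and b u - a v give both summands the same size: both vectors have
    S-form 2 a^2 b^2, while their M-forms differ by 4 a b times the M-product of u and v. *)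
Lemma pair_close_cross (f : R) u v :
  (forall q, close_at S M f (pair_test S u v q)) -> bf S u v = 0 ->
  `|bf M u v| <= f * (Num.sqrt (bf S u u) * Num.sqrt (bf S v v)).
Proof.
move=> h uv0.
have [->|u0] := eqVneq u 0; first by rewrite !bf0l normr0 sqrtr0 mul0r mulr0.
have [->|v0] := eqVneq v 0; first by rewrite !bf0r normr0 sqrtr0 !mulr0.
set a := Num.sqrt (bf S u u); set b := Num.sqrt (bf S v v).
have a0 : 0 < a by rewrite sqrtr_gt0 pdS.
have b0 : 0 < b by rewrite sqrtr_gt0 pdS.
have ab0 : 0 < a * b by rewrite mulr_gt0.
have a2 : bf S u u = a ^+ 2 by rewrite sqr_sqrtr.
have b2 : bf S v v = b ^+ 2 by rewrite sqr_sqrtr.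
have := h (inord 2); have := h (inord 3); rewrite /close_at /pair_test !inordK//=.
rewrite -/a -/b -!scaleNr.
rewrite !(bf_sqD symM) !(bf_sqD symS) !bfZl !bfZr uv0 a2 b2 !ler_norml.
move=> /andP[h1 h2] /andP[h3 h4].
have ab4 : 0 < 4 * (a * b) by rewrite mulr_gt0.
by apply/andP; split; rewrite -(ler_pM2l ab4); lra.
Qed.

(** The two squares contribute f, and the cross term another f by AM-GM. *)
Lemma pair_close_plane (f : R) u v (x y : R) :
  0 <= f -> (forall q, close_at S M f (pair_test S u v q)) -> bf S u v = 0 ->
  close_at S M (2 * f) (x *: u + y *: v).
Proof.
move=> f0 h uv0; have := pair_close_cross h uv0.
have := h (inord 0); have := h (inord 1); rewrite /close_at /pair_test !inordK//=.
rewrite (bf_sqD symM) (bf_sqD symS) !bfZl !bfZr uv0.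
have := sqr_sqrtr (psdS u); have := sqr_sqrtr (psdS v).
set a := Num.sqrt (bf S u u); set b := Num.sqrt (bf S v v) => <- <-.
move=> /ler_normlP [v1 v2] /ler_normlP [u1 u2] /ler_normlP [c1 c2].
have amgm : 2 * `|x * y * (a * b)| <= x ^+ 2 * a ^+ 2 + y ^+ 2 * b ^+ 2.
  have := sqr_ge0 (x * a - y * b); have := sqr_ge0 (x * a + y * b) => g1 g2.
  have [h0|h0] := lerP 0 (x * y * (a * b)); first by rewrite ger0_norm//; lra.
  by rewrite ltr0_norm//; lra.
have cross : `|2 * (x * y * bf M u v)| <= f * (x ^+ 2 * a ^+ 2 + y ^+ 2 * b ^+ 2).
  rewrite !normrM (ger0_norm (_ : 0 <= 2 :> R))//.
  apply: (@le_trans _ _ (f * (2 * `|x * y * (a * b)|))); last by rewrite ler_wpM2l.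
  have -> : f * (2 * `|x * y * (a * b)|) = 2 * (`|x| * `|y| * (f * `|a * b|)).
    by rewrite !normrM; ring.
  rewrite ler_wpM2l// ler_wpM2l ?mulr_ge0// (ger0_norm (_ : 0 <= a * b)).
    by apply/ler_normlP.
  by rewrite mulr_ge0 ?sqrtr_ge0.
have X1 : `|x ^+ 2 * (bf M u u - a ^+ 2)| <= f * (x ^+ 2 * a ^+ 2).
  rewrite normrM (ger0_norm (sqr_ge0 x)) mulrCA ler_wpM2l ?sqr_ge0//.
  by apply/ler_normlP.
have Y1 : `|y ^+ 2 * (bf M v v - b ^+ 2)| <= f * (y ^+ 2 * b ^+ 2).
  rewrite normrM (ger0_norm (sqr_ge0 y)) mulrCA ler_wpM2l ?sqr_ge0//.
  by apply/ler_normlP.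
rewrite [X in `|X|](_ : _ = x ^+ 2 * (bf M u u - a ^+ 2) +
  y ^+ 2 * (bf M v v - b ^+ 2) + 2 * (x * y * bf M u v)); last by ring.
apply: le_trans (ler_normD _ _) _.
apply: le_trans (lerD (ler_normD _ _) (lexx _)) _.
lra.
Qed.

Lemma bf_atom j k : bf S (atom S j k) (rvec S j j) = 0.
Proof.
by rewrite /atom; case: eqP => [_|/eqP kj]; rewrite ?bf0l// bf_rvecjj.
Qed.

Lemma bf_sparse_comb j (U : N.-tuple ('I_n * bool)) :
  bf S (sparse_comb S j U) (rvec S j j) = 0.
Proof. by rewrite bf_suml big1// => i _; rewrite bfZl bf_atom mulr0. Qed.

Hypothesis goodM : good_sample S M e e0 N.

Lemma sparse_close j (U : N.-tuple ('I_n * bool)) (x y : R) :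
  close_at S M (2 * e) (x *: sparse_comb S j U + y *: rvec S j j).
Proof.
by apply: pair_close_plane => //; [exact: goodM.1|exact: bf_sparse_comb].
Qed.

Lemma atom_close j k (x y : R) :
  close_at S M (2 * e) (x *: atom S j k + y *: rvec S j j).
Proof.
(* A single atom is, up to scale, the sum of N copies of itself. *)
have := sparse_close j [tuple of nseq N (k, false)] (x / N%:R) y.
have -> // : x / N%:R *: sparse_comb S j [tuple of nseq N (k, false)] = x *: atom S j k.
rewrite /sparse_comb big_nseq/= iter_addr addr0 expr0 scale1r.
rewrite -(scaler_nat N (atom S j k)) scalerA.
by rewrite divfK// pnatr_eq0; case: N N_gt1.
Qed.

Lemma xi_cross i j k : i != j -> k != i ->
  `|bf M (xi S i) (rvec S j k)| <= e0 * Num.sqrt (Th i i)^-1.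
Proof.
move=> ij ki.
have := @pair_close_cross e0 (xi S i) (rvec S j k) (goodM.2 i j k).
rewrite bf_xixi// bf_rvec// sqrtr1 mulr1; apply.
by rewrite bf_xi// rvec_coord0 ?mulr0// eq_sym.
Qed.

Lemma xi_close i (j : 'I_n) : close_at S M e0 (xi S i).
Proof.
by have := goodM.2 i j j (inord 0); rewrite /pair_test inordK.
Qed.

Definition lin_comb j (c : 'I_n -> R) (b : R) : 'rV[R]_n :=
  \sum_k c k *: atom S j k + b *: rvec S j j.

(** Pythagoras: the atoms are orthogonal to the unit vector [rvec S j j]. This is the only control
    on the unpenalized coefficient. *)
Lemma bf_lin_comb j c b : b ^+ 2 <= bf S (lin_comb j c b) (lin_comb j c b).
Proof.
rewrite /lin_comb; have z1 := bf_rvec pdS j j.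
have vz : bf S (\sum_k c k *: atom S j k) (rvec S j j) = 0.
  by rewrite bf_suml big1// => k _; rewrite bfZl bf_atom mulr0.
move: (rvec S j j) z1 vz => z z1 vz.
rewrite (bf_sqD symS) !bfZr !bfZl z1 vz !mulr0 addr0 mulr1 -expr2 lerDr.
exact: psdS.
Qed.

Lemma xi_lin_comb i j c b : i != j -> c i = 0 -> 0 <= e0 ->
  `|bf M (xi S i) (lin_comb j c b)| <=
  e0 * Num.sqrt (Th i i)^-1 * (\sum_k `|c k| + `|b|).
Proof.
move=> ij ci0 e00; rewrite bfDr bf_sumr bfZr.
apply: le_trans (ler_normD _ _) _; rewrite mulrDr lerD//; last first.
  by rewrite normrM mulrC ler_wpM2r// xi_cross// eq_sym.
apply: le_trans (ler_norm_sum _ _ _) _.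
rewrite mulr_sumr; apply: ler_sum => k _; rewrite bfZr normrM mulrC.
have [->|ki] := eqVneq k i; first by rewrite ci0 normr0 !mulr0.
rewrite ler_wpM2r// /atom; case: eqP => _; last exact: xi_cross.
by rewrite bf0r normr0 mulr_ge0// sqrtr_ge0.
Qed.

(** Sparsification is applied to the form s (M - S) + 2 e S, nonnegative on sparse sums and at most
    4 e on atoms. The two signs s together give a two-sided bound. *)
Let lin_comb_bound (s : R) j c b : `|s| = 1 ->
  - ((\sum_k `|c k|) ^+ 2 * (4 * e) / (N%:R - 1)) <=
  s * (bf M (lin_comb j c b) (lin_comb j c b) -
       bf S (lin_comb j c b) (lin_comb j c b)) +
  2 * e * bf S (lin_comb j c b) (lin_comb j c b).
Proof.
move=> s1; pose D := s *: M + (2 * e - s) *: S.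
have symD : D^T = D by rewrite /D linearD !linearZ/= symM symS.
have DE w : bf D w w = s * (bf M w w - bf S w w) + 2 * e * bf S w w.
  by rewrite bf_mx_lin; ring.
have sle w t : close_at S M t w -> `|s * (bf M w w - bf S w w)| <= t * bf S w w.
  by rewrite normrM s1 mul1r.
rewrite -DE.
apply: (@sparse_lower_bound _ _ _ _ symD (atom S j) (rvec S j j) N (4 * e) c b
  j N_gt1).
- move=> U x y; rewrite -/(sparse_comb S j U) DE.
  have /sle/ler_normlP[h _] := sparse_close j U x y.
  lra.
- move=> k; rewrite DE.
  have := atom_close j k 1 0; rewrite scale0r addr0 scale1r => /sle/ler_normlP[_ h].
  have : bf S (atom S j k) (atom S j k) <= 1.
    by rewrite /atom; case: eqP => _; rewrite ?bf0l// bf_rvec.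
  move/(ler_wpM2l e_ge0); lra.
- by rewrite mulr_ge0.
Qed.

Lemma lin_comb_close j c b :
  `|bf M (lin_comb j c b) (lin_comb j c b) - bf S (lin_comb j c b) (lin_comb j c b)|
  <= 2 * e * bf S (lin_comb j c b) (lin_comb j c b) +
     (\sum_k `|c k|) ^+ 2 * (4 * e) / (N%:R - 1).
Proof.
have h1 := @lin_comb_bound 1 j c b (normr1 _).
have h2 := @lin_comb_bound (-1) j c b (normrN1 _).
rewrite ler_norml; apply/andP; split; lra.
Qed.

End good_sample.

(** * The algorithm *)

Section empirical_quantities.
Context (R : realType) (m n : nat).
Implicit Types (x : 'I_m -> n.-tuple R) (i j k : 'I_n).

Lemma lf_evec k (y : n.-tuple R) : lf (evec k) y = tnth y k.
Proof.
rewrite /lf (bigD1 k)//= evec_coord eqxx mul1r big1 ?addr0// => l lk.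
by rewrite evec_coord (negbTE lk) mul0r.
Qed.

Lemma lfD (u v : 'rV[R]_n) y : lf (u + v) y = lf u y + lf v y.
Proof. by rewrite /lf -big_split/=; apply: eq_bigr => k _; rewrite mxE mulrDl. Qed.

Lemma lfZ a (u : 'rV[R]_n) y : lf (a *: u) y = a * lf u y.
Proof. by rewrite /lf mulr_sumr; apply: eq_bigr => k _; rewrite mxE mulrA. Qed.

Lemma lfB (u v : 'rV[R]_n) y : lf (u - v) y = lf u y - lf v y.
Proof. by rewrite -scaleN1r lfD lfZ mulN1r. Qed.

Lemma lf_sum (I : Type) (r : seq I) (Q : pred I) (F : I -> 'rV[R]_n) y :
  lf (\sum_(i <- r | Q i) F i) y = \sum_(i <- r | Q i) lf (F i) y.
Proof.
elim/big_rec2: _ => [|i a u _ <-]; last by rewrite lfD.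
by rewrite -(scale0r 0) lfZ mul0r.
Qed.

Definition loss_vec x i j (w : 'I_n -> R) (a : R) : 'rV[R]_n :=
  evec i - \sum_(k < n | (k != i) && (k != j))
    (w k / Num.sqrt (cond_var_hat x k j)) *: evec k - a *: evec j.

Lemma emp_mean_sq_loss x1 x i j w a :
  emp_mean x (sq_loss x1 i j w a) =
  bf (emp_cov x) (loss_vec x1 i j w a) (loss_vec x1 i j w a).
Proof.
rewrite bf_emp_cov /emp_mean; congr (_ * _); apply: eq_bigr => s _.
rewrite -expr2 /sq_loss /loss_vec !lfB lfZ !lf_evec lf_sum; congr ((_ - _ - _) ^+ 2).
by apply: eq_bigr => k _; rewrite lfZ lf_evec mulrAC mulrA.
Qed.

Lemma cond_var_hat_ge x k j (c : R) : (1 < m)%N -> 0 <= c ->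
  (forall b, c <= bf (emp_cov x) (evec k - b *: evec j) (evec k - b *: evec j)) ->
  c <= cond_var_hat x k j.
Proof.
move=> m1 c0 h; rewrite /cond_var_hat.
have m1' : 0 < m%:R - 1 :> R by rewrite subr_gt0 ltr1n.
rewrite mulrC ler_pdivlMr//; apply: lb_le_inf.
  by exists (\sum_(s < m) (tnth (x s) k - 0 * tnth (x s) j) ^+ 2); exists 0.
move=> _ [b _ <-]; apply: (@le_trans _ _ (m%:R * c)); first by nra.
have -> : \sum_(s < m) (tnth (x s) k - b * tnth (x s) j) ^+ 2 =
    m%:R * bf (emp_cov x) (evec k - b *: evec j) (evec k - b *: evec j).
  rewrite bf_emp_cov mulrA mulfV ?mul1r; last by rewrite pnatr_eq0 -lt0n ltnW.
  by apply: eq_bigr => s _; rewrite lfB lfZ !lf_evec expr2.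
by rewrite ler_wpM2l.
Qed.

(** The estimate divides by m - 1 and [emp_cov] by m; the ratio is at most 1001/1000 here. *)
Lemma cond_var_hat_le x k j b (c : R) : (1000 < m)%N ->
  bf (emp_cov x) (evec k - b *: evec j) (evec k - b *: evec j) <= c ->
  cond_var_hat x k j <= 1001 / 1000 * c.
Proof.
move=> m1 h; rewrite /cond_var_hat.
have m1' : 1001 <= m%:R :> R by rewrite (ler_nat R 1001).
rewrite mulrC ler_pdivrMr; last lra.
have c0 : 0 <= c by apply: le_trans h; exact: emp_cov_ge0.
apply: (@le_trans _ _ (m%:R * c)); last by nra.
apply: (@le_trans _ _ (\sum_(s < m) (tnth (x s) k - b * tnth (x s) j) ^+ 2)).
  apply: ge_inf; last by exists b.
  by exists 0 => _ [b' _ <-]; apply: sumr_ge0 => s _; rewrite sqr_ge0.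
have -> : \sum_(s < m) (tnth (x s) k - b * tnth (x s) j) ^+ 2 =
    m%:R * bf (emp_cov x) (evec k - b *: evec j) (evec k - b *: evec j).
  rewrite bf_emp_cov mulrA mulfV ?mul1r; last by rewrite gt_eqF//; lra.
  by apply: eq_bigr => s _; rewrite lfB lfZ !lf_evec expr2.
by rewrite ler_wpM2l//; lra.
Qed.

End empirical_quantities.

(** * Existence of Lasso minimizers *)

Section minimizer.
Context (R : realType) (n : nat).
Local Open Scope classical_set_scope.

Lemma continuous_finsum (T : topologicalType) (I : Type) (r : seq I) (Q : pred I)
    (F : I -> T -> R) :
  (forall i, continuous (F i)) ->
  continuous (fun t => \sum_(i <- r | Q i) F i t).
Proof.
move=> cF; elim: r => [|i r IH] t.
  by under eq_fun do rewrite big_nil; exact: cvg_cst.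
under eq_fun do rewrite big_cons.
case: (Q i); last exact: IH.
by apply: continuousD; [exact: cF|exact: IH].
Qed.

Lemma continuous_mul (T : topologicalType) (f g : T -> R) :
  continuous f -> continuous g -> continuous (fun t => f t * g t).
Proof. by move=> cf cg t; apply: cvgM; [exact: cf|exact: cg]. Qed.

Lemma continuous_sub (T : topologicalType) (f g : T -> R) :
  continuous f -> continuous g -> continuous (fun t => f t - g t).
Proof. by move=> cf cg t; apply: (@cvgB _ R^o); [exact: cf|exact: cg]. Qed.

Lemma continuous_bf (T : topologicalType) (M : 'M[R]_n) (u v : T -> 'rV[R]_n) :
  (forall k, continuous (fun t => u t 0 k)) ->
  (forall k, continuous (fun t => v t 0 k)) ->
  continuous (fun t => bf M (u t) (v t)).
Proof.
move=> cu cv; under eq_fun do rewrite bfE.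
apply: continuous_finsum => k; apply: continuous_finsum => l.
apply: continuous_mul => //.
by apply: continuous_mul => //; exact: cst_continuous.
Qed.

Lemma lasso_minimizer_exists (m : nat) (x1 x2 : 'I_m -> n.-tuple R)
    (i j : 'I_n) (lambda : R) : 0 <= lambda ->
  0 < bf (emp_cov x2) (evec j) (evec j) ->
  exists w a, lasso_minimizer x1 x2 i j lambda w a.
Proof.
move=> lam0 B0; set M := emp_cov x2 in B0 *.
have symM : M^T = M := emp_cov_sym x2.
set B := bf M (evec j) (evec j) in B0.
pose A (v : 'rV[R]_n) : 'rV[R]_n := loss_vec x1 i j (fun k => v 0 k) 0.
have AE w a : loss_vec x1 i j w a = loss_vec x1 i j w 0 - a *: evec j.
  by rewrite /loss_vec scale0r subr0.
have sq v a : bf M (A v - a *: evec j) (A v - a *: evec j) =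
    bf M (A v) (A v) - bf M (A v) (evec j) ^+ 2 / B +
    B * (a - bf M (A v) (evec j) / B) ^+ 2.
  rewrite -scaleNr (bf_sqD symM) !bfZl !bfZr -/B; field.
  by rewrite gt_eqF.
(* The unbounded coefficient [a] is eliminated by minimizing over it first. *)
pose g v := bf M (A v) (A v) - bf M (A v) (evec j) ^+ 2 / B.
have cA k : continuous (fun v : 'rV[R]_n => A v 0 k).
  have -> : (fun v : 'rV[R]_n => A v 0 k) = (fun v : 'rV[R]_n =>
      (evec i : 'rV[R]_n) 0 k - \sum_(l < n | (l != i) && (l != j))
        v 0 l * ((evec l : 'rV[R]_n) 0 k / Num.sqrt (cond_var_hat x1 l j))).
    apply/funext => v; rewrite /A /loss_vec scale0r subr0 mxE [X in _ + X]mxE summxE.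
    by congr (_ - _); apply: eq_bigr => l _; rewrite mxE mulrAC mulrA.
  apply: continuous_sub; first exact: cst_continuous.
  apply: continuous_finsum => l.
  by apply: continuous_mul; [exact: coord_continuous|exact: cst_continuous].
have cg : continuous g.
  apply: continuous_sub; first exact: continuous_bf.
  apply: continuous_mul; last exact: cst_continuous.
  have ce : continuous (fun v => bf M (A v) (evec j)).
    by apply: continuous_bf => // k; exact: cst_continuous.
  by under eq_fun do rewrite expr2; exact: continuous_mul.
pose L (v : 'rV[R]_n) := l1_norm i j (fun k => v 0 k).
have cL : continuous L.
  apply: continuous_finsum => k v.
  by apply: continuous_comp; [exact: coord_continuous|exact: norm_continuous].
(* The l1 norm does not see the entries i and j, so the box is needed for compactness. A competitor
   is brought into it by setting these entries to 0, which leaves its loss unchanged. *)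
pose K := [set v : 'rV[R]_n | forall k, `[- lambda, lambda] (v ord0 k)] `&`
  L @^-1` [set r | r <= lambda].
have cK : compact K.
  apply: compact_closedI.
    apply: (@rV_compact _ n (fun _ => `[- lambda, lambda])) => _.
    exact: segment_compact.
  by apply: preimage_closed; [move=> v _; exact: cL|exact: closed_le].
have K0 : K !=set0.
  exists 0; split=> /=.
    by move=> k; rewrite mxE /= in_itv/= oppr_le0 lam0.
  by rewrite /L /l1_norm big1// => k _; rewrite mxE normr0.
have [v vK vmin] := EVT_min_rV K0 cK (continuous_subspaceT cg).
have {vK}[_ vL] := set_mem vK.
exists (fun k => v 0 k), (bf M (A v) (evec j) / B); split=> // w a wL.
rewrite !emp_mean_sq_loss -/M.
pose w' : 'rV[R]_n := \row_k (if (k != i) && (k != j) then w k else 0).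
have w'E : loss_vec x1 i j w 0 = A w'.
  rewrite /A /loss_vec; congr (_ - _ - _); apply: eq_bigr => k kij.
  by rewrite mxE kij.
have w'L : L w' <= lambda.
  rewrite /L /l1_norm; apply: le_trans wL; apply: ler_sum => k kij.
  by rewrite mxE kij.
have w'K : w' \in K.
  apply/mem_set; split=> //= k; rewrite /= in_itv/= -ler_norml.
  have [kij|kij] := boolP ((k != i) && (k != j)); last first.
    by rewrite mxE (negbTE kij) normr0.
  apply: le_trans w'L; rewrite /L /l1_norm (bigD1 k)//= lerDl.
  by apply: sumr_ge0.
rewrite (AE w a) (AE (fun k => v 0 k)) w'E -/(A v) !sq -/(g v) -/(g w').
rewrite subrr expr0n/= mulr0 addr0.
apply: le_trans (vmin _ w'K) _.
by rewrite lerDl mulr_ge0 ?sqr_ge0// ltW.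
Qed.

End minimizer.

(** This bound serves for the feasibility of the last radius; the upper bound 4 limits the growth of
    the radius in one iteration. *)
Lemma expR1_ge (R : realType) : 9 / 4 <= expR 1 :> R.
Proof.
have -> : expR 1 = expR (1 / 2) * expR (1 / 2) :> R.
  by rewrite -expRD; congr expR; field.
have := expR_ge1Dx (1 / 2 : R); nra.
Qed.

Lemma expR1_le (R : realType) : expR 1 <= 4 :> R.
Proof.
have h := expR_ge1Dx (- (1 / 2) : R).
have e0 : 0 < expR (1 / 2) :> R by exact: expR_gt0.
have h1 : expR (1 / 2) <= 2 :> R.
  have : expR (1 / 2) * expR (- (1 / 2)) = 1 :> R by rewrite -expRD subrr expR0.
  nra.
have -> : expR 1 = expR (1 / 2) * expR (1 / 2) :> R.
  by rewrite -expRD; congr expR; field.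
nra.
Qed.

(** Here p is the cross term and q the quadratic term of an empirical excess loss; 1/180 rounds up
    1/2000 + 1/200, and 1/80 rounds up 21/2000 + 1/1000. *)
Lemma abs_sum_bound (R : realType) (Q t p q : R) : 0 <= t -> 0 <= Q ->
  `|p| <= 21 / 2000 * t + Q / 2000 -> `|q - Q| <= Q / 200 + t / 1000 ->
  Q - Q / 180 - t / 80 <= p + q <= Q + Q / 180 + t / 80.
Proof.
move=> t0 Q0 /ler_normlP[h1 h2] /ler_normlP[h3 h4].
by apply/andP; split; lra.
Qed.

Lemma sqrt_le_scale (R : realType) (a b c : R) : 0 <= c -> a <= c ^+ 2 * b ->
  Num.sqrt a <= c * Num.sqrt b.
Proof.
move=> c0 ab; apply: le_trans (ler_wsqrtr ab) _.
by rewrite sqrtrM ?sqr_ge0// sqrtr_sqr ger0_norm.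
Qed.

(** A and B are the residual variances of the two nodes, t minus the true coefficient, g the error
    and K = kappa^2. Without an edge u^2 vb is at most 1.2 K A / 64, against a threshold of at least
    K A / 10; with an edge it is at least 0.5 K A, against at most 0.15 K A. *)
Lemma edge_test_arith (R : realType) (K t g A B u va vb : R) :
  0 < K -> 0 < A -> 0 < B -> u = - t - g -> g ^+ 2 * B <= K * A / 64 ->
  8 / 10 * A <= va <= 12 / 10 * A -> 8 / 10 * B <= vb <= 12 / 10 * B ->
  t = 0 \/ K * A <= t ^+ 2 * B ->
  (K / 8 * va <= u ^+ 2 * vb) = (t != 0).
Proof.
move=> K0 A0 B0 uE gB /andP[va1 va2] /andP[vb1 vb2].
have KA : 0 < K * A by exact: mulr_gt0.
have Kva1 := ler_wpM2l (ltW K0) va1; have Kva2 := ler_wpM2l (ltW K0) va2.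
have u1 := ler_wpM2l (sqr_ge0 u) vb1; have u2 := ler_wpM2l (sqr_ge0 u) vb2.
case=> [t0|tB].
  rewrite t0 eqxx; apply/negbTE; rewrite -ltNge.
  have uB : u ^+ 2 * B = g ^+ 2 * B by rewrite uE t0; ring.
  lra.
have -> : t != 0.
  by apply: contraTneq tB => ->; rewrite expr0n/= mul0r -ltNge.
(* It bounds the product t g from below, so that u^2 B >= 3/4 t^2 B - 3 g^2 B. *)
have : 0 <= (t / 2 + 2 * g) ^+ 2 * B by rewrite mulr_ge0 ?sqr_ge0// ltW.
have : u ^+ 2 * B = t ^+ 2 * B + 2 * (t * g * B) + g ^+ 2 * B by rewrite uE; ring.
have -> : (t / 2 + 2 * g) ^+ 2 * B =
    t ^+ 2 * B / 4 + 2 * (t * g * B) + 4 * (g ^+ 2 * B) by field.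
move: (t * g * B) => tgB uB h.
by apply/idP; lra.
Qed.

Lemma eq_edge_set (p : nat) (e e' : rel 'I_p) :
  (forall i k, i != k -> e i k = e' i k) -> edge_set e = edge_set e'.
Proof.
move=> ee; apply/setP => x; apply/imsetP/imsetP => -[q];
  rewrite !inE => /andP[q12 eq] ->; exists q => //; rewrite !inE q12.
  by rewrite -ee.
by rewrite ee.
Qed.

(** * Deterministic analysis of the algorithm on good samples *)

Section ws_analysis.
Context (R : realType) (m n d N : nat) (S : 'M[R]_n) (kappa : R)
  (x1 x2 x3 : 'I_m -> n.-tuple R).
Let Th := invmx S.
Let D := Num.sqrt (d%:R : R).
Hypothesis unitS : S \in unitmx.
Hypothesis symS : S^T = S.
Hypothesis pdS : forall u, u != 0 -> 0 < bf S u u.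
Hypothesis sddTh : SDD Th.
Hypothesis kappa01 : 0 < kappa <= 1.
Hypothesis n_gt1 : (1 < n)%N.
Hypothesis d_ge1 : (1 <= d)%N.
Hypothesis degTh : forall i, (#|[set j | ggm_adjacent Th i j]%SET| <= d)%N.
Hypothesis m_gt1000 : (1000 < m)%N.
Hypothesis N_ge : 1000 * d%:R / kappa ^+ 2 <= N%:R - 1.
Let e0 := kappa ^+ 2 / (2000 * D).
Let good (M : 'M[R]_n) := good_sample S M (1 / 400) e0 N.
Hypothesis good1 : good (emp_cov x1).
Hypothesis good2 : good (emp_cov x2).
Hypothesis good3 : good (emp_cov x3).

Let kappa_gt0 : 0 < kappa. Proof. by case/andP: kappa01. Qed.

Let k2_gt0 : 0 < kappa ^+ 2. Proof. exact: exprn_gt0. Qed.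

Let k2_le1 : kappa ^+ 2 <= 1.
Proof. by case/andP: kappa01 => k0 k1; rewrite expr_le1// ltW. Qed.

Let d_ge1R : 1 <= d%:R :> R. Proof. by rewrite ler1n. Qed.

Let D_ge1 : 1 <= D.
Proof. by rewrite -sqrtr1 ler_wsqrtr. Qed.

Let D2 : D ^+ 2 = d%:R.
Proof. by rewrite sqr_sqrtr// ler0n. Qed.

Let N_gt1 : (1 < N)%N.
Proof.
rewrite -(ltr_nat R); apply: (@lt_le_trans _ _ (1 + 1000 * d%:R / kappa ^+ 2)).
  have h : 0 < 1000 * d%:R :> R by have := d_ge1R; lra.
  by rewrite ltrDl; exact: divr_gt0.
by rewrite addrC -lerBrDr.
Qed.

Let e0E : e0 * D = kappa ^+ 2 / 2000.
Proof. by rewrite /e0; field; rewrite gt_eqF//; have := D_ge1; lra. Qed.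

Let e0_ge0 : 0 <= e0.
Proof.
have h : 0 <= 2000 * D by have := D_ge1; lra.
exact: divr_ge0 (ltW k2_gt0) h.
Qed.

Let e0_le : e0 <= kappa ^+ 2 / 2000.
Proof. by rewrite -e0E ler_peMr. Qed.

Let sg i := Num.sqrt (Th i i)^-1.

Let sg_gt0 i : 0 < sg i.
Proof. by rewrite sqrtr_gt0 invr_gt0 precision_diag_gt0. Qed.

Let sg2 i : sg i ^+ 2 = (Th i i)^-1.
Proof. by rewrite sqr_sqrtr// invr_ge0 ltW// precision_diag_gt0. Qed.

(** In the cross term the l1 part costs 2 * 10 * [e0] D sigma^2 = kappa^2 sigma^2 / 100, and [b] is
    absorbed by 2 sigma |b| <= sigma^2 + Q. In the quadratic term the choice of N makes the
    sparsification error at most kappa^2 sigma^2 / 1000. *)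
Lemma good_estimates (M : 'M[R]_n) i j (c : 'I_n -> R) (b : R) :
  M^T = M -> good M -> i != j -> c i = 0 ->
  \sum_k `|c k| <= 10 * (D * sg i) ->
  let f := lin_comb S j c b in
  let Q := bf S f f in
  let t := kappa ^+ 2 * sg i ^+ 2 in
  [/\ `|2 * bf M (xi S i) f| <= 21 / 2000 * t + Q / 2000,
      `|bf M f f - Q| <= Q / 200 + t / 1000 &
      `|bf M (xi S i) (xi S i) - sg i ^+ 2| <= sg i ^+ 2 / 2000].
Proof.
move=> symM gM ij ci0 cL f Q t.
have e400 : 0 <= 1 / 400 :> R by lra.
have [D1 k0 k1 d1] := And4 D_ge1 k2_gt0 k2_le1 d_ge1R.
have bQ : b ^+ 2 <= Q by exact: bf_lin_comb.
have Q0 : 0 <= Q by exact: bf_pd_ge0.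
have t0 : 0 <= t by rewrite mulr_ge0 ?sqr_ge0.
have s0 := sg_gt0 i.
split.
- have := xi_lin_comb unitS symS pdS symM gM b ij ci0 e0_ge0.
  rewrite -/Th -/(sg i) -/f normrM (ger0_norm (_ : 0 <= 2 :> R))// => h.
  have h1 : e0 * sg i * \sum_k `|c k| <= kappa ^+ 2 / 200 * sg i ^+ 2.
    apply: (@le_trans _ _ (e0 * sg i * (10 * (D * sg i)))).
      by rewrite ler_wpM2l// mulr_ge0// ltW.
    rewrite [leLHS](_ : _ = 10 * (e0 * D) * sg i ^+ 2); last by ring.
    by rewrite e0E; lra.
  have h2 : 2 * (e0 * sg i * `|b|) <= e0 * (sg i ^+ 2 + Q).
    have : 0 <= (sg i - `|b|) ^+ 2 by exact: sqr_ge0.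
    rewrite sqrrB real_normK ?num_real// => h3.
    by rewrite -mulrA mulrCA ler_wpM2l//; lra.
  have h3 : e0 * (sg i ^+ 2 + Q) <= kappa ^+ 2 / 2000 * sg i ^+ 2 + Q / 2000.
    rewrite mulrDr lerD//; first by rewrite ler_wpM2r ?sqr_ge0.
    rewrite mulrC ler_wpM2l//; apply: le_trans e0_le _; lra.
  rewrite /t; lra.
- have := lin_comb_close symS pdS symM e400 N_gt1 gM j c b.
  rewrite -/f -/Q => /le_trans; apply.
  have h : (\sum_k `|c k|) ^+ 2 <= 100 * (d%:R * sg i ^+ 2).
    rewrite -D2 -exprMn (_ : 100 = 10 ^+ 2 :> R); last by ring.
    have h0 : 0 <= 10 * (D * sg i) by apply: le_trans cL; exact: sumr_ge0.
    by rewrite -exprMn lerXn2r ?nnegrE// sumr_ge0.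
  have N0 : 0 < N%:R - 1 :> R by rewrite subr_gt0 ltr1n.
  have hN : d%:R / (N%:R - 1) <= kappa ^+ 2 / 1000.
    rewrite ler_pdivrMr//.
    have := ler_wpM2l (ltW k0) N_ge.
    have -> : kappa ^+ 2 * (1000 * d%:R / kappa ^+ 2) = 1000 * d%:R.
      by field; rewrite gt_eqF.
    lra.
  have : (\sum_k `|c k|) ^+ 2 * (4 * (1 / 400)) / (N%:R - 1) <= t / 1000.
    apply: (@le_trans _ _ (100 * (d%:R * sg i ^+ 2) * (4 * (1 / 400)) / (N%:R - 1))).
      by rewrite ler_pM2r ?invr_gt0//; lra.
    rewrite [leLHS](_ : _ = sg i ^+ 2 * (d%:R / (N%:R - 1))); last first.
      by field; rewrite gt_eqF.
    have := ler_wpM2l (sqr_ge0 (sg i)) hN; rewrite /t; lra.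
  lra.
- have := xi_close gM i j; rewrite /close_at bf_xixi// -/Th -sg2.
  move=> /le_trans; apply; rewrite mulrC ler_wpM2l ?sqr_ge0//.
  by apply: le_trans e0_le _; lra.
Qed.

Lemma evec_atom j k b : k != j ->
  evec k - b *: evec j = Num.sqrt (cvar S j k) *: atom S j k +
    ((S k j / S j j - b) * Num.sqrt (S j j)) *: rvec S j j.
Proof.
move=> kj; rewrite {1}(evec_rvec pdS j k) {1}(evec_rvec pdS j j) eqxx scale0r addr0.
rewrite (negbTE kj) (rscale_neq S kj) /atom (negbTE kj) scalerA -addrA -scalerBl.
by rewrite /rscale eqxx mulrBl.
Qed.

(** All vectors [evec k - b *: evec j] lie in the plane of one atom and X_j, where accuracy is
    uniform in b. The lower bound uses this for every b, the upper bound at the true coefficient. *)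
Lemma cond_var_hat_close k j : k != j ->
  99 / 100 * cvar S j k <= cond_var_hat x1 k j <= 101 / 100 * cvar S j k.
Proof.
move=> kj; have e400 : 0 <= 1 / 400 :> R by lra.
have V0 := cvar_gt0 pdS kj.
have cl b : close_at S (emp_cov x1) (2 * (1 / 400)) (evec k - b *: evec j).
  by rewrite evec_atom//; apply: atom_close good1 _ _ _ _ => //; exact: emp_cov_sym.
apply/andP; split.
  apply: cond_var_hat_ge; [exact: ltn_trans m_gt1000|lra|move=> b].
  have := cvar_le symS pdS j k b.
  by have /ler_normlP[h _] := cl b; lra.
apply: (@le_trans _ _ (1001 / 1000 * (402 / 400 * cvar S j k))); last lra.
apply: (@cond_var_hat_le _ _ _ _ _ _ (S k j / S j j)) => //.
have := bf_res_shift symS pdS j k (S k j / S j j).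
rewrite subrr expr0n/= mul0r addr0 => <-.
by have /ler_normlP[_ h] := cl (S k j / S j j); lra.
Qed.


(** The true coefficient of X_k in the regression of X_i is [- (Th i k / Th i i)]; this is its
    difference with the estimate. *)
Let gap i j w a k : R :=
  - (Th i k / Th i i) - (if k == j then a else w k / Num.sqrt (cond_var_hat x1 k j)).

(** The same errors in the basis of atoms, which are scaled by the true conditional deviations while
    the algorithm uses estimated ones. *)
Let coefs i j (w : 'I_n -> R) k : R :=
  if (k != i) && (k != j) then
    (- (Th i k / Th i i) - w k / Num.sqrt (cond_var_hat x1 k j)) *
      Num.sqrt (cvar S j k)
  else 0.

(** The coefficient of X_i is 1 both in the loss vector and in [xi S i], so their difference
    involves only the other variables. *)
Lemma loss_vec_decomp i j w a : j != i -> exists b,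
  loss_vec x1 i j w a = xi S i + lin_comb S j (coefs i j w) b /\
  forall k, k != i -> lin_comb S j (coefs i j w) b 0 k = gap i j w a k.
Proof.
move=> ji; have [b hb] := sum_evec_rvec pdS (gap i j w a) ji.
have lE : \sum_(k < n | k != i) gap i j w a k *: evec k =
    lin_comb S j (coefs i j w) b.
  rewrite hb /lin_comb; congr (_ + _); rewrite big_mkcond/=; apply: eq_bigr => k _.
  rewrite /coefs /atom /gap; case: (eqVneq k i) => [_|ki] /=; first by rewrite scale0r.
  by case: (eqVneq k j) => [_|kj]; rewrite ?scale0r// rscale_neq.
exists b; rewrite -lE; split; last first.
  move=> k ki; rewrite summxE (bigD1 k)//= big1 => [|l /andP[_ lk]].
    by rewrite addr0 mxE evec_coord eqxx mulr1.
  by rewrite mxE evec_coord eq_sym (negbTE lk) mulr0.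
apply/rowP => k; rewrite /loss_vec !mxE.
rewrite !summxE eqxx/=.
have [->|ki] := eqVneq k i.
  rewrite eq_sym (negbTE ji) mulr0 subr0 mulVf ?gt_eqF ?precision_diag_gt0//.
  rewrite !big1 ?subr0 ?addr0// => l; last first.
    by case/andP=> li _; rewrite mxE evec_coord eq_sym (negbTE li) mulr0.
  by move=> li; rewrite mxE evec_coord eq_sym (negbTE li) mulr0.
rewrite [in RHS](bigD1 k)//= [X in _ = _ + (_ + X)]big1 ?addr0; last first.
  by move=> l /andP[_ lk]; rewrite mxE evec_coord eq_sym (negbTE lk) mulr0.
rewrite mxE evec_coord eqxx mulr1 /gap.
have [->|kj] := eqVneq k j.
  rewrite big1 => [|l /andP[_ lj]].
    by rewrite -/Th /=; ring.
  by rewrite mxE evec_coord eq_sym (negbTE lj) mulr0.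
rewrite (bigD1 k) ?ki ?kj//= big1 ?addr0.
  by rewrite mxE evec_coord eqxx -/Th /=; ring.
by move=> l /andP[_ lk]; rewrite mxE evec_coord eq_sym (negbTE lk) mulr0.
Qed.

Lemma sqrt_cond_var_hat_le k j : k != j ->
  Num.sqrt (cond_var_hat x1 k j) <= 1005 / 1000 * Num.sqrt (cvar S j k).
Proof.
move=> kj; have /andP[_ h] := cond_var_hat_close kj.
have V0 := cvar_gt0 pdS kj.
by apply: sqrt_le_scale; lra.
Qed.

Lemma sqrt_cvar_le k j : k != j ->
  Num.sqrt (cvar S j k) <= 1006 / 1000 * Num.sqrt (cond_var_hat x1 k j).
Proof.
move=> kj; have /andP[h _] := cond_var_hat_close kj.
have V0 := cvar_gt0 pdS kj.
by apply: sqrt_le_scale; lra.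
Qed.

Let true_l1 i j := \sum_(k < n | (k != i) && (k != j))
  `|Th i k| / Th i i * Num.sqrt (cvar S j k).

Lemma true_l1_le_sqrt i j : j != i ->
  true_l1 i j <= D * sg i + Num.sqrt (cvar S j i).
Proof.
move=> ji; have := true_l1_le unitS symS pdS sddTh ji d_ge1 (degTh i).
by rewrite sqrtrM ?ler0n.
Qed.

Lemma true_l1_le_const i j : j != i ->
  cvar S j i <= 205 / 100 * (d%:R * sg i ^+ 2) ->
  true_l1 i j <= 244 / 100 * (D * sg i).
Proof.
move=> ji V; apply: le_trans (true_l1_le_sqrt ji) _.
have DS : Num.sqrt (d%:R * sg i ^+ 2) = D * sg i.
  by rewrite sqrtrM ?ler0n// sqrtr_sqr ger0_norm// ltW.
have ds0 : 0 <= d%:R * sg i ^+ 2 by rewrite mulr_ge0 ?sqr_ge0 ?ler0n.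
have := @sqrt_le_scale R (cvar S j i) (d%:R * sg i ^+ 2) (144 / 100).
by rewrite DS => h; have := h ltac:(lra) ltac:(lra); lra.
Qed.

Lemma coefs_l1 i j w : j != i ->
  \sum_k `|coefs i j w k| <= true_l1 i j + 1006 / 1000 * l1_norm i j w.
Proof.
move=> ji; rewrite /true_l1 /l1_norm mulr_sumr -big_split/= [leRHS]big_mkcond/=.
apply: ler_sum => k _; rewrite /coefs; case: ifP => [/andP[ki kj]|_]; last by rewrite normr0.
have t0 := precision_diag_gt0 unitS pdS i.
have V0 := cvar_gt0 pdS kj.
have /andP[hV _] := cond_var_hat_close kj.
have H0 : 0 < Num.sqrt (cond_var_hat x1 k j) by rewrite sqrtr_gt0; lra.
rewrite normrM (ger0_norm (sqrtr_ge0 _)).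
apply: (@le_trans _ _ ((`|Th i k| / Th i i + `|w k| / Num.sqrt (cond_var_hat x1 k j)) *
    Num.sqrt (cvar S j k))).
  rewrite ler_wpM2r ?sqrtr_ge0//; apply: le_trans (ler_normB _ _) _.
  by rewrite normrN !normrM !normfV (gtr0_norm t0) (gtr0_norm H0).
rewrite mulrDl lerD2l mulrAC ler_pdivrMr//.
have := ler_wpM2l (normr_ge0 (w k)) (sqrt_cvar_le kj); lra.
Qed.


Let loss i j w a := bf S (loss_vec x1 i j w a - xi S i) (loss_vec x1 i j w a - xi S i).

(** The bound 2 d sigma^2 holds for some conditioner; the one chosen minimizes an estimate, which
    costs a factor 101/99. *)
Let small_var i j := cvar S j i <= 205 / 100 * (d%:R * sg i ^+ 2).

Let t_le i : 0 <= kappa ^+ 2 * sg i ^+ 2 <= sg i ^+ 2.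
Proof.
rewrite mulr_ge0 ?sqr_ge0 ?(ltW k2_gt0)//=.
by rewrite ler_piMl ?sqr_ge0.
Qed.

Lemma iter_estimates (M : 'M[R]_n) i j w a s : j != i -> small_var i j ->
  M^T = M -> good M -> 0 <= s <= 20 * sg i ^+ 2 ->
  l1_norm i j w <= Num.sqrt (2 * d%:R) * Num.sqrt s ->
  let Q := loss i j w a in
  let t := kappa ^+ 2 * sg i ^+ 2 in
  let l := bf M (loss_vec x1 i j w a) (loss_vec x1 i j w a) in
  let l0 := bf M (xi S i) (xi S i) in
  [/\ 0 <= Q,
      Q - Q / 180 - t / 80 <= l - l0 <= Q + Q / 180 + t / 80 &
      `|l0 - sg i ^+ 2| <= sg i ^+ 2 / 2000].
Proof.
move=> ji sv symM gM /andP[s0 s20] wl.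
have ij : i != j by rewrite eq_sym.
have [b [lE _]] := loss_vec_decomp w a ji.
have ds0 : 0 <= d%:R * sg i ^+ 2 by rewrite mulr_ge0 ?sqr_ge0 ?ler0n.
(* 6.33 rounds up sqrt 40. *)
have lam : Num.sqrt (2 * d%:R) * Num.sqrt s <= 633 / 100 * (D * sg i).
  have -> : Num.sqrt (2 * d%:R) * Num.sqrt s = Num.sqrt (2 * d%:R * s).
    by rewrite -sqrtrM// mulr_ge0 ?ler0n.
  have -> : D * sg i = Num.sqrt (d%:R * sg i ^+ 2).
    by rewrite sqrtrM ?ler0n// sqrtr_sqr ger0_norm// ltW.
  apply: sqrt_le_scale; first lra.
  have := ler_wpM2l (ler0n R d) s20; lra.
(* The constants are 2.44 for the true vector and 1.006 * 6.33 for the estimate. *)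
have L : \sum_k `|coefs i j w k| <= 10 * (D * sg i).
  have := coefs_l1 w ji; have := true_l1_le_const ji sv.
  have : 0 <= D * sg i by rewrite mulr_ge0 ?sqrtr_ge0.
  lra.
have ci0 : coefs i j w i = 0 by rewrite /coefs eqxx.
have [h1 h2 h3] := good_estimates b symM gM ij ci0 L.
move=> Q t l l0.
have QE : Q = bf S (lin_comb S j (coefs i j w) b) (lin_comb S j (coefs i j w) b).
  by rewrite /Q /loss lE addrAC subrr add0r.
have Q0 : 0 <= Q by rewrite QE; exact: bf_pd_ge0.
move: h1 h2 h3; rewrite -QE -/t -/l0 => h1 h2 h3.
have ll : l - l0 = 2 * bf M (xi S i) (lin_comb S j (coefs i j w) b) +
    bf M (lin_comb S j (coefs i j w) b) (lin_comb S j (coefs i j w) b).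
  by rewrite /l lE (bf_sqD symM) -/l0; ring.
have := t_le i; rewrite -/t => /andP[t0 _].
by split=> //; rewrite ll; exact: abs_sum_bound.
Qed.

Let wstar i j k := - (Th i k / Th i i) * Num.sqrt (cond_var_hat x1 k j).
Let astar i j := - (Th i j / Th i i).

Lemma loss_vec_true i j : j != i ->
  loss_vec x1 i j (wstar i j) (astar i j) = xi S i.
Proof.
move=> ji; have [b [-> h]] := loss_vec_decomp (wstar i j) (astar i j) ji.
have H0 k : k != j -> Num.sqrt (cond_var_hat x1 k j) != 0.
  move=> kj; have /andP[hV _] := cond_var_hat_close kj.
  by have := cvar_gt0 pdS kj => V0; rewrite gt_eqF// sqrtr_gt0; lra.
have g0 k : k != i -> gap i j (wstar i j) (astar i j) k = 0.
  move=> ki; rewrite /gap /wstar /astar; case: eqP => [->|/eqP kj].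
    by rewrite subrr.
  by rewrite mulfK ?H0// subrr.
have c0 k : coefs i j (wstar i j) k = 0.
  rewrite /coefs; case: ifP => // /andP[ki kj].
  by have := g0 k ki; rewrite /gap (negbTE kj) => ->; rewrite mul0r.
have f0 : lin_comb S j (coefs i j (wstar i j)) b = 0.
  apply/rowP => k; rewrite [RHS]mxE; have [->|ki] := eqVneq k i; last by rewrite h// g0.
  rewrite /lin_comb big1 ?add0r => [|l _]; last by rewrite c0 scale0r.
  by rewrite mxE rvec_coord0// ?mulr0// eq_sym.
by rewrite f0 addr0.
Qed.

Lemma l1_norm_true i j : j != i ->
  l1_norm i j (wstar i j) <= 1005 / 1000 * true_l1 i j.
Proof.
move=> ji; rewrite /l1_norm /true_l1 mulr_sumr; apply: ler_sum => k /andP[ki kj].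
have t0 := precision_diag_gt0 unitS pdS i.
rewrite normrM normrN normrM normfV (gtr0_norm t0) (ger0_norm (sqrtr_ge0 _)).
rewrite [leRHS]mulrCA ler_wpM2l ?sqrt_cond_var_hat_le//.
by rewrite divr_ge0// ltW.
Qed.

Let s2 := s_sq x1 d.

Let good_output i j w a (v : R) :=
  loss i j w a <= kappa ^+ 2 * sg i ^+ 2 / 64 /\
  8 / 10 * sg i ^+ 2 <= v <= 12 / 10 * sg i ^+ 2.

(** The excess loss is almost nonnegative on the third sample, whether or not the true vector is
    feasible; hence the exit test cannot succeed at a small radius. *)
Lemma iter_lower i j w a s : j != i -> small_var i j ->
  0 <= s <= 20 * sg i ^+ 2 ->
  l1_norm i j w <= Num.sqrt (2 * d%:R) * Num.sqrt s ->
  8 / 10 * sg i ^+ 2 <= emp_mean x3 (sq_loss x1 i j w a).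
Proof.
move=> ji sv s20 wl; rewrite emp_mean_sq_loss.
have [Q0 /andP[h _] /ler_normlP[h1 _]] := iter_estimates a ji sv (emp_cov_sym x3) good3 s20 wl.
have /andP[t0 t1] := t_le i; lra.
Qed.

(** On the second sample the minimizer does no worse than the true vector, so 179/180 Q <= kappa^2
    sigma^2 / 80, and Q is below kappa^2 sigma^2 / 64. The third sample then evaluates the loss. *)
Lemma iter_optimal i j w a s : j != i -> small_var i j ->
  0 <= s <= 20 * sg i ^+ 2 ->
  1005 / 1000 * true_l1 i j <= Num.sqrt (2 * d%:R) * Num.sqrt s ->
  lasso_minimizer x1 x2 i j (Num.sqrt (2 * d%:R) * Num.sqrt s) w a ->
  good_output i j w a (emp_mean x3 (sq_loss x1 i j w a)).
Proof.
move=> ji sv s20 feas [wl wmin].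
have l3 := iter_lower a ji sv s20 wl.
have := wmin (wstar i j) (astar i j) (le_trans (l1_norm_true ji) feas).
rewrite !emp_mean_sq_loss loss_vec_true//.
have [Q0 /andP[h2 _] _] := iter_estimates a ji sv (emp_cov_sym x2) good2 s20 wl.
have [_ /andP[_ h3] /ler_normlP[_ h4]] := iter_estimates a ji sv (emp_cov_sym x3) good3 s20 wl.
move=> opt; have /andP[t0 t1] := t_le i.
have Qs : loss i j w a <= kappa ^+ 2 * sg i ^+ 2 / 64 by lra.
split=> //; move: l3; rewrite emp_mean_sq_loss => ->/=; lra.
Qed.


Let s_sq_ge0 i j l : 0 <= s2 i j l.
Proof. by rewrite mulr_ge0 ?expR_ge0. Qed.

Let s_sqS i j l : s2 i j l.+1 = expR 1 * s2 i j l.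
Proof. by rewrite /s2 /s_sq -natr1 expRD; ring. Qed.

Let eight_d_gt0 : 0 < 8 * d%:R :> R.
Proof. by have := d_ge1R; lra. Qed.

Lemma s_sq0_le i j : j != i -> small_var i j -> s2 i j 0 <= 20 * sg i ^+ 2.
Proof.
move=> ji sv; rewrite /s2 /s_sq expR0 mulr1 /s0_sq.
have ij : i != j by rewrite eq_sym.
have /andP[hV1 hV2] := cond_var_hat_close ij.
have V0 := cvar_gt0 pdS ij.
set V := cond_var_hat x1 i j in hV1 hV2 *.
have VV : 0 < V / (8 * d%:R) by rewrite divr_gt0//; lra.
apply: (@le_trans _ _ (V / (8 * d%:R))).
  rewrite -[leRHS]lnK ?posrE// ler_expR.
  have fl := floor_le (ln (V / (8 * d%:R))).
  by apply: (@le_trans _ _ (ln (V / (8 * d%:R)))) => //; lra.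
rewrite ler_pdivrMr//.
have := sv; rewrite /small_var => h.
have : 0 <= d%:R * sg i ^+ 2 by rewrite mulr_ge0 ?sqr_ge0 ?ler0n.
lra.
Qed.

(** The floor and the -1 in [s0_sq] lose at most two units in the exponent; the 3 in [last_iter]
    restores them and leaves a factor e. *)
Lemma s_sq_last_ge i j : j != i ->
  9 / 4 * cond_var_hat x1 i j <= s2 i j (last_iter R d).
Proof.
move=> ji; rewrite /s2 /s_sq /s0_sq -expRD.
have ij : i != j by rewrite eq_sym.
have /andP[hV1 hV2] := cond_var_hat_close ij.
have V0 := cvar_gt0 pdS ij.
set V := cond_var_hat x1 i j in hV1 hV2 *.
have Vgt : 0 < V by lra.
have VV : 0 < V / (8 * d%:R) by rewrite divr_gt0.
have last : ln (8 * d%:R) + 3 <= (last_iter R d)%:R :> R.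
  rewrite /last_iter; set z := Num.ceil _.
  apply: (@le_trans _ _ (z%:~R)); first exact: ceil_ge.
  by rewrite pmulrn ler_int lez_abs.
have fl : ln (V / (8 * d%:R)) - 1 <= (Num.floor (ln (V / (8 * d%:R))))%:~R.
  have := floorD1_gt (ln (V / (8 * d%:R))); rewrite intrD; lra.
have lnE : ln (V / (8 * d%:R)) = ln V - ln (8 * d%:R) by rewrite ln_div ?posrE.
apply: (@le_trans _ _ (expR (1 + ln V))).
  by rewrite expRD lnK ?posrE// ler_wpM2r ?expR1_ge// ltW.
by rewrite ler_expR; lra.
Qed.

(** The threshold 3.1 lies below 3.2 = 2^2 * 0.8, which a successful exit test guarantees, and 2 *
    3.1 exceeds 2.46^2. *)
Lemma feasible_of_large i j s : j != i -> small_var i j ->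
  31 / 10 * sg i ^+ 2 <= s ->
  1005 / 1000 * true_l1 i j <= Num.sqrt (2 * d%:R) * Num.sqrt s.
Proof.
move=> ji sv hs.
have s0 : 0 <= s by have := sqr_ge0 (sg i); lra.
have h := true_l1_le_const ji sv.
have Ds0 : 0 <= D * sg i by rewrite mulr_ge0 ?sqrtr_ge0.
have -> : Num.sqrt (2 * d%:R) * Num.sqrt s = Num.sqrt (2 * d%:R * s).
  by rewrite -sqrtrM// mulr_ge0 ?ler0n.
apply: (@le_trans _ _ (246 / 100 * (D * sg i))).
  by lra.
have -> : 246 / 100 * (D * sg i) = Num.sqrt ((246 / 100 * (D * sg i)) ^+ 2).
  by rewrite sqrtr_sqr ger0_norm; lra.
apply: ler_wsqrtr; rewrite !exprMn D2.
have := ler_wpM2l (ler0n R d) hs.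
have : 0 <= d%:R * sg i ^+ 2 by rewrite mulr_ge0 ?sqr_ge0 ?ler0n.
lra.
Qed.

(** Since sigma is at most the deviation W of X_i given X_j, the true l1 norm is at most 2 D W; the
    last radius squared is at least 2 d * 9/4 times the estimate of W^2. *)
Lemma feasible_last i j : j != i ->
  1005 / 1000 * true_l1 i j <=
  Num.sqrt (2 * d%:R) * Num.sqrt (s2 i j (last_iter R d)).
Proof.
move=> ji; have ij : i != j by rewrite eq_sym.
have /andP[hV1 hV2] := cond_var_hat_close ij.
have V0 := cvar_gt0 pdS ij.
have hs := s_sq_last_ge ji.
have h := true_l1_le_sqrt ji.
have hsg : sg i <= Num.sqrt (cvar S j i).
  by rewrite ler_wsqrtr// cvar_ge.
have -> : Num.sqrt (2 * d%:R) * Num.sqrt (s2 i j (last_iter R d)) =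
    Num.sqrt (2 * d%:R * s2 i j (last_iter R d)).
  by rewrite -sqrtrM// mulr_ge0 ?ler0n.
set W := Num.sqrt (cvar S j i) in h hsg.
have W0 : 0 <= W by exact: sqrtr_ge0.
have D1 := D_ge1.
have DW0 : 0 <= D * W by rewrite mulr_ge0 ?sqrtr_ge0.
apply: (@le_trans _ _ (201 / 100 * (D * W))).
  have : D * sg i <= D * W by rewrite ler_wpM2l//; lra.
  have : W <= D * W by rewrite ler_peMl.
  lra.
have -> : 201 / 100 * (D * W) = Num.sqrt ((201 / 100 * (D * W)) ^+ 2).
  by rewrite sqrtr_sqr ger0_norm; lra.
apply: ler_wsqrtr; rewrite !exprMn D2 /W sqr_sqrtr ?(ltW V0)//.
have dV : 0 <= d%:R * cvar S j i by rewrite mulr_ge0 ?ler0n// ltW.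
have h1 := ler_wpM2l (ler0n R d) hs.
have h2 := ler_wpM2l (ler0n R d) hV1.
lra.
Qed.

(** The bound 20 sigma^2 is the loop invariant. If the test fails, either s^2 < 3.1 sigma^2, or the
    true vector is feasible and s^2 < 4 * 1.2 sigma^2; in both cases s^2 <= 5 sigma^2, and the next
    value is at most 4 times larger. *)
Lemma ws_loop_good i j l r : j != i -> small_var i j ->
  ws_loop x1 x2 x3 2 d i j l r -> s2 i j l <= 20 * sg i ^+ 2 ->
  exists w a v, r = WSResult w a j v /\ good_output i j w a v.
Proof.
move=> ji sv; elim=> {l r} [l w a v lm stop|l w a r v lm test _ _ IH] s20.
  have s020 : 0 <= s2 i j l <= 20 * sg i ^+ 2 by rewrite s_sq_ge0.
  have low := iter_lower a ji sv s020 lm.1.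
  exists w, a, v; split=> //; apply: iter_optimal lm => //.
  case: stop => [stop|->]; last exact: feasible_last.
  apply: feasible_of_large => //.
  by move: stop low; rewrite -/(s2 i j l) -/v; lra.
have s020 : 0 <= s2 i j l <= 20 * sg i ^+ 2 by rewrite s_sq_ge0.
apply: IH; rewrite s_sqS.
have sl0 := s_sq_ge0 i j l.
have : s2 i j l <= 5 * sg i ^+ 2.
  have [small|/ltW big] := lerP (s2 i j l) (31 / 10 * sg i ^+ 2).
    by have := sqr_ge0 (sg i); lra.
  have feas := feasible_of_large ji sv big.
  have [_ /andP[_ vle]] := iter_optimal ji sv s020 feas lm.
  by move: test vle; rewrite -/(s2 i j l) -/v; have := sqr_ge0 (sg i); lra.
have := expR1_le R; nra.
Qed.

Lemma ws_regression_good i r : ws_regression x1 x2 x3 2 d i r ->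
  exists w a v j, [/\ r = WSResult w a j v, j != i & good_output i j w a v].
Proof.
move=> [j [ji jmin loop]].
have sv : small_var i j.
  have [k ki hk] := exists_good_conditioner unitS symS pdS sddTh d_ge1 n_gt1 (degTh i).
  have ij : i != j by rewrite eq_sym.
  have ik : i != k by rewrite eq_sym.
  have /andP[h1 _] := cond_var_hat_close ij.
  have /andP[_ h2] := cond_var_hat_close ik.
  have h3 := jmin k ki.
  rewrite /small_var sg2 -/Th; rewrite -/Th in hk.
  have : 0 <= d%:R * (Th i i)^-1 by rewrite mulr_ge0 ?ler0n// -sg2 sqr_ge0.
  lra.
have [w [a [v [rE g]]]] := ws_loop_good ji sv loop (s_sq0_le ji sv).
by exists w, a, v, j.
Qed.


Hypothesis ndTh : kappa_nondegenerate kappa Th.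

Lemma emp_var_gt0 j : 0 < bf (emp_cov x2) (evec j) (evec j).
Proof.
have e400 : 0 <= 1 / 400 :> R by lra.
have := atom_close symS pdS (emp_cov_sym x2) e400 N_gt1 good2 j j 0 1.
rewrite scale0r add0r scale1r /close_at bf_rvec// => /ler_normlP[h _].
have := evec_rvec pdS j j; rewrite eqxx scale0r addr0 => ->.
have h1 := rscale_gt0 pdS j j.
move: (rvec S j j) h => z h; rewrite bfZl bfZr.
by rewrite !mulr_gt0//; lra.
Qed.

Lemma ws_loop_exists i j l : j != i -> (l <= last_iter R d)%N ->
  exists r, ws_loop x1 x2 x3 2 d i j l r.
Proof.
move=> ji /subnKC; move: (_ - l)%N => p; elim: p l => [|p IH] l lE.
all: have lam0 : 0 <= Num.sqrt (2 * d%:R) * Num.sqrt (s2 i j l) by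
  rewrite mulr_ge0 ?sqrtr_ge0.
all: have [w [a lm]] := lasso_minimizer_exists x1 i lam0 (emp_var_gt0 j).
  exists (WSResult w a j (emp_mean x3 (sq_loss x1 i j w a))).
  by apply: WSStop lm _; right; rewrite -lE addn0.
have [stop|go] := lerP (2 ^+ 2 * emp_mean x3 (sq_loss x1 i j w a)) (s2 i j l).
  exists (WSResult w a j (emp_mean x3 (sq_loss x1 i j w a))).
  by apply: WSStop lm _; left.
have [r hr] := IH l.+1 ltac:(by rewrite addSnnS).
by exists r; apply: WSNext lm go _ hr; rewrite -lE -addSnnS leq_addr.
Qed.

Lemma ws_regression_exists i : exists r, ws_regression x1 x2 x3 2 d i r.
Proof.
have [k ki _] := exists_good_conditioner unitS symS pdS sddTh d_ge1 n_gt1 (degTh i).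
have [j ji jmin] := @Order.TotalTheory.arg_minP _ R _ k
  (fun k => k != i) (fun k => cond_var_hat x1 i k) ki.
have [r hr] := ws_loop_exists ji (leq0n _).
by exists r, j; split.
Qed.

Lemma coef_close i r k : ws_regression x1 x2 x3 2 d i r -> k != i ->
  8 / 10 * sg i ^+ 2 <= ws_sigma2 r <= 12 / 10 * sg i ^+ 2 /\
  exists g, regression_coef x1 r k = - (Th i k / Th i i) - g /\
    g ^+ 2 * sg k ^+ 2 <= kappa ^+ 2 * sg i ^+ 2 / 64.
Proof.
move=> /ws_regression_good[w [a [v [j [-> ji [hl hv]]]]]] ki; split=> //.
exists (gap i j w a k); rewrite /regression_coef /= /gap opprB addrCA subrr addr0.
split; first by [].
have [b [lE lk]] := loss_vec_decomp w a ji.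
apply: le_trans hl; rewrite sg2 -/(gap i j w a k) -(lk k ki) /loss lE addrAC subrr add0r.
exact: coord_sq_le.
Qed.

Lemma edge_test i k ri rk : i != k ->
  ws_regression x1 x2 x3 2 d i ri -> ws_regression x1 x2 x3 2 d k rk ->
  (kappa ^+ 2 / 8 * ws_sigma2 ri <= regression_coef x1 ri k ^+ 2 * ws_sigma2 rk)
  = (Th i k != 0).
Proof.
move=> ik wi wk; have ki : k != i by rewrite eq_sym.
have [vi [g [uE gB]]] := coef_close wi ki.
have [vk _] := coef_close wk ik.
have ti := precision_diag_gt0 unitS pdS i; rewrite -/Th in ti.
have tk := precision_diag_gt0 unitS pdS k; rewrite -/Th in tk.
have s2i : 0 < sg i ^+ 2 by exact: exprn_gt0.
have s2k : 0 < sg k ^+ 2 by exact: exprn_gt0.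
rewrite (edge_test_arith k2_gt0 s2i s2k uE gB vi vk).
  by rewrite mulf_eq0 invr_eq0 (gt_eqF ti) orbF.
have [->|T0] := eqVneq (Th i k) 0; first by left; rewrite mul0r.
right; have := ndTh ik T0.
have r0 : 0 < Num.sqrt (Th i i * Th k k) by rewrite sqrtr_gt0 mulr_gt0.
rewrite ler_pdivlMr// => h.
have : (kappa * Num.sqrt (Th i i * Th k k)) ^+ 2 <= `|Th i k| ^+ 2.
  by rewrite lerXn2r ?nnegrE// mulr_ge0// ltW.
rewrite exprMn sqr_sqrtr ?mulr_ge0 ?(ltW ti) ?(ltW tk)// real_normK ?num_real// => h2.
rewrite !sg2 expr_div_n.
have -> : kappa ^+ 2 * (Th i i)^-1 = kappa ^+ 2 * (Th i i * Th k k) / (Th i i ^+ 2 * Th k k).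
  by field; rewrite !gt_eqF.
have -> : Th i k ^+ 2 / Th i i ^+ 2 * (Th k k)^-1 = Th i k ^+ 2 / (Th i i ^+ 2 * Th k k).
  by field; rewrite !gt_eqF.
by rewrite ler_pM2r// invr_gt0 mulr_gt0// exprn_gt0.
Qed.

(** The direction from right to left says that the algorithm does return an output, which rests on
    the existence of Lasso minimizers at every iteration. *)
Lemma hybrid_mb_correct (E : {set {set 'I_n}}) :
  hybrid_mb x1 x2 x3 (kappa ^+ 2 / 8) 2 d E <-> E = edge_set (ggm_adjacent Th).
Proof.
have edges r : (forall i, ws_regression x1 x2 x3 2 d i (r i)) ->
    edge_set (fun i k =>
      (kappa ^+ 2 / 8 * ws_sigma2 (r i) <=
         regression_coef x1 (r i) k ^+ 2 * ws_sigma2 (r k)) &&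
      (kappa ^+ 2 / 8 * ws_sigma2 (r k) <=
         regression_coef x1 (r k) i ^+ 2 * ws_sigma2 (r i))) =
    edge_set (ggm_adjacent Th).
  move=> hr; apply: eq_edge_set => i k ik; have ki : k != i by rewrite eq_sym.
  rewrite (edge_test ik (hr i) (hr k)) (edge_test ki (hr k) (hr i)).
  have /matrixP/(_ i k) := precision_sym symS; rewrite mxE -/Th => ->.
  by rewrite andbb /ggm_adjacent ik.
split=> [[r hr ->]|->]; first exact: edges.
have [r hr] := choice ws_regression_exists.
by exists r => //; apply/esym; exact: edges.
Qed.

End ws_analysis.

(** * Number of tests and failure probability *)

Section counting.
Context (R : realType).

Lemma max_degree_ge1_size (n : nat) (Th : 'M[R]_n) :
  (1 <= max_degree Th)%N -> (1 < n)%N.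
Proof.
move=> d1; rewrite ltnNge; apply/negP => n1; move: d1.
rewrite leqNgt ltnS => /negP; apply; apply/bigmax_leqP => i _.
rewrite leqn0 cards_eq0; apply/eqP/setP => j; rewrite !inE.
rewrite (_ : i = j) /ggm_adjacent ?eqxx//; apply: val_inj => /=.
have li := leq_trans (ltn_ord i) n1; have lj := leq_trans (ltn_ord j) n1.
by move: li lj; rewrite !ltnS !leqn0 => /eqP -> /eqP ->.
Qed.

(** The factor 24 counts three samples, four vectors of [pair_test] and two tails. Every count is
    bounded by a power of n / delta, so that its logarithm is a multiple of [L]; the second sum
    needs m of order d / kappa^4, the first only of order N. *)
Lemma failure_prob_le (n d m N : nat) (kappa delta : R) :
  (1 < n)%N -> (1 <= d)%N -> 0 < kappa <= 1 -> 0 < delta < 1 ->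
  N%:R <= 1000 * d%:R / kappa ^+ 2 + 2 ->
  2048 * 2000 ^+ 2 * 100 * (d%:R / kappa ^+ 4) * ln (n%:R / delta) <= m%:R ->
  1001 <= m%:R :> R /\
  24 * (n%:R * (2 * n%:R) ^+ N) * expR (- (m%:R * (1 / 400) ^+ 2 / 2048)) +
  24 * n%:R ^+ 3 *
    expR (- (m%:R * (kappa ^+ 2 / (2000 * Num.sqrt d%:R)) ^+ 2 / 2048)) <= delta.
Proof.
move=> n1 d1 /andP[k0 k1] /andP[e0 e1] hN.
set y := d%:R / kappa ^+ 4; set L := ln _.
have n2 : 2 <= n%:R :> R by rewrite ler_nat.
have d1' : 1 <= d%:R :> R by rewrite ler1n.
have kp2 : 0 < kappa ^+ 2 by exact: exprn_gt0.
have kp4 : 0 < kappa ^+ 4 by exact: exprn_gt0.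
have k21 : kappa ^+ 2 <= 1 by rewrite expr_le1// ltW.
have k42 : kappa ^+ 4 <= kappa ^+ 2.
  by rewrite (_ : 4 = 2 + 2)%N// exprD ler_piMl// ltW.
pose rho := n%:R / delta.
have rho_n : n%:R <= rho by rewrite /rho ler_pdivlMr//; nra.
have rho0 : 0 < rho by lra.
have rhoE : rho = expR L by rewrite /L lnK// posrE.
have L2 : 1 / 2 <= L.
  rewrite -ler_expR -rhoE.
  have h : expR (1 / 2) * expR (1 / 2) = expR 1 :> R.
    by rewrite -expRD; congr expR; field.
  have := expR1_le R; have := expR_gt0 (1 / 2 : R); nra.
have y1 : 1 <= y.
  by rewrite /y ler_pdivlMr// mul1r; lra.
have ydk : d%:R / kappa ^+ 2 <= y.
  by rewrite /y ler_wpM2l// ?lef_pV2 ?posrE//; lra.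
have yL : y / 2 <= y * L by nra.
have yL0 : L <= y * L by nra.
have rho_pow p : rho ^+ p = expR (p%:R * L) by rewrite rhoE expRM_natl.
have rho24 : 24 <= rho ^+ 5.
  have : 2 ^+ 5 <= rho ^+ 5 :> R by rewrite lerXn2r ?nnegrE//; lra.
  lra.
(* The left side is delta / n, and n >= 2. *)
have target : expR (- L) <= delta / 2.
  rewrite expRN -rhoE /rho invf_div ler_wpM2l ?lef_pV2 ?posrE//; lra.
have bound p c K : 0 <= K -> K <= rho ^+ p -> (p%:R + 1) * L <= m%:R * c ->
    K * expR (- (m%:R * c)) <= delta / 2.
  move=> K0 Kp hc; apply: le_trans target.
  apply: (@le_trans _ _ (rho ^+ p * expR (- (m%:R * c)))).
    by rewrite ler_wpM2r ?expR_ge0.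
  by rewrite rho_pow -expRD ler_expR; lra.
have two_n : 2 * n%:R <= rho ^+ 2 by rewrite expr2; nra.
move=> hm; have mbig : 1001 <= m%:R :> R by clear -hm yL y1; lra.
have B1 : 24 * (n%:R * (2 * n%:R) ^+ N) *
    expR (- (m%:R * ((1 / 400) ^+ 2 / 2048))) <= delta / 2.
  apply: (bound (6 + 2 * N)%N).
  - by rewrite mulr_ge0 ?ler0n// mulr_ge0 ?ler0n// exprn_ge0// mulr_ge0 ?ler0n.
  - rewrite exprD exprSr -mulrA exprM.
    have p1 : 0 <= (2 * n%:R) ^+ N :> R by rewrite exprn_ge0// mulr_ge0 ?ler0n.
    have p2 : (2 * n%:R) ^+ N <= rho ^+ 2 ^+ N.
      apply: lerXn2r two_n; rewrite nnegrE; last exact: exprn_ge0 (ltW rho0).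
      by rewrite mulr_ge0 ?ler0n.
    have p3 : n%:R * (2 * n%:R) ^+ N <= rho * rho ^+ 2 ^+ N.
      by apply: ler_pM => //; rewrite ler0n.
    by apply: ler_pM.
  - have -> : ((6 + 2 * N)%:R + 1 : R) = 7 + 2 * N%:R by rewrite natrD natrM; clear; lra.
    have : (7 + 2 * N%:R) * L <= (11 + 2000 * y) * L.
      by apply: ler_wpM2r; clear -hN ydk L2; lra.
    clear -hm yL0 L2; lra.
have B2 : 24 * n%:R ^+ 3 *
    expR (- (m%:R * ((kappa ^+ 2 / (2000 * Num.sqrt d%:R)) ^+ 2 / 2048)))
    <= delta / 2.
  apply: (bound 8%N).
  - by rewrite mulr_ge0 ?ler0n// exprn_ge0.
  - have n3 : 0 <= n%:R ^+ 3 :> R by rewrite exprn_ge0.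
    rewrite (_ : 8 = 5 + 3)%N// exprD; apply: ler_pM rho24 _ => //.
    by apply: lerXn2r rho_n; rewrite nnegrE ?ler0n// ltW.
  - have -> : (kappa ^+ 2 / (2000 * Num.sqrt d%:R)) ^+ 2 / 2048 =
        (y * (2048 * 2000 ^+ 2))^-1.
      have s0 : 0 < Num.sqrt (d%:R : R) by rewrite sqrtr_gt0; clear -d1'; lra.
      rewrite /y -[in RHS](sqr_sqrtr (ler0n R d)); field.
      by rewrite !gt_eqF.
    have c0 : 0 < y * (2048 * 2000 ^+ 2) by clear -y1; lra.
    by rewrite ler_pdivlMr//; clear -hm yL0 L2; lra.
split=> //; rewrite -!(mulrA m%:R); clear -B1 B2; lra.
Qed.

End counting.

Theorem theorem17 (R : realType) :
  exists2 C : R, 0 < C &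
  forall (n d m : nat) (Sigma : 'M[R]_n) (kappa delta : R)
    (dT : measure_display) (T : measurableType dT) (P : probability T R)
    (X : 'I_3 -> 'I_m -> {RV P >-> n.-tuple R}),
  let Theta := invmx Sigma in
  Sigma \in unitmx ->
  (forall (b : 'I_3) (s : 'I_m), gaussian_vector P Sigma (X b s)) ->
  mutually_independent P (fun p : 'I_3 * 'I_m => X p.1 p.2) ->
  SDD Theta ->
  0 < kappa <= 1 ->
  kappa_nondegenerate kappa Theta ->
  max_degree Theta = d ->
  (1 <= d)%N ->
  0 < delta < 1 ->
  C * (d%:R / kappa ^+ 4) * ln (n%:R / delta) <= m%:R ->
  exists2 G : set T, measurable G /\ ((1 - delta)%:E <= P G)%E &
  forall t : T, G t ->
    let x b s := X b s t in
    forall E : {set {set 'I_n}},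
      hybrid_mb (x ord0) (x (inord 1)) (x (inord 2)) (kappa ^+ 2 / 8) 2 d E <->
      E = edge_set (ggm_adjacent Theta).
Proof.
exists (2048 * 2000 ^+ 2 * 100); first by clear; lra.
move=> n d m Sigma kappa delta dT T P X Th uS gX indX sdd k01 nd dmax d1 de01 hm.
have n1 : (1 < n)%N by apply: (@max_degree_ge1_size _ _ Th); rewrite dmax.
have [k0 k1] : 0 < kappa /\ kappa <= 1 by case/andP: k01.
have d1' : 1 <= d%:R :> R by rewrite ler1n.
have k20 : 0 < kappa ^+ 2 by exact: exprn_gt0.
pose z := 1000 * d%:R / kappa ^+ 2.
have z0 : 0 <= z by apply: divr_ge0 (ltW k20); clear -d1'; lra.
have [N [Nle Nge]] : exists N : nat, N%:R <= z + 2 /\ z <= N%:R - 1.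
  (* Truncation may lose almost one unit, and the bounds involve N - 1. *)
  exists (Num.truncn z).+2; split.
    by rewrite -addn2 natrD lerD2r truncn_le.
  have := truncnS_gt z; rewrite -[in (Num.truncn z).+2]addn1 natrD; clear; lra.
have [m1 fail] := failure_prob_le n1 d1 k01 de01 Nle hm.
have m1000 : (1000 < m)%N by rewrite -(ler_nat R 1001).
have m0 : (0 < m)%N by exact: leq_trans m1000.
set e0 := kappa ^+ 2 / (2000 * Num.sqrt d%:R) in fail.
have D1 : 1 <= Num.sqrt (d%:R : R) by have := ler_wsqrtr d1'; rewrite sqrtr1.
have e01 : 0 < e0 <= 1.
  have D0 : 0 < 2000 * Num.sqrt (d%:R : R) by clear -D1; lra.
  have k21 : kappa ^+ 2 <= 1 by rewrite expr_le1// ltW.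
  rewrite /e0 (divr_gt0 k20 D0)/= (ler_pdivrMr _ _ D0).
  by clear -D1 k21; lra.
have [A SE] : exists A : 'M[R]_n, A *m A^T = Sigma.
  by have [A [Z [SE _ _ _]]] := gX ord0 (Ordinal m0); exists A.
have symS : Sigma^T = Sigma by rewrite -SE trmx_mul trmxK.
have pdS u : u != 0 -> 0 < bf Sigma u u.
  by move=> u0; rewrite -SE bf_mulmx_tr_gt0// SE.
(* All tests of [good_sample] in one finite type; none depends on the data, so one union bound
   covers them. *)
pose I := (('I_n * N.-tuple ('I_n * bool)) * 'I_4 + ('I_n * 'I_n * 'I_n) * 'I_4)%type.
pose v (i : I) : 'rV[R]_n := match i with
  | inl (j, U, q) => pair_test Sigma (sparse_comb Sigma j U) (rvec Sigma j j) q
  | inr (i, j, k, q) => pair_test Sigma (xi Sigma i) (rvec Sigma j k) q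
  end.
pose e (i : I) : R := if i is inl _ then 1 / 400 else e0.
have ei i : 0 < e i <= 1 by case: i => [_|_] //=; apply/andP; split; clear; lra.
have [B [mB PB hB]] := emp_cov_concentration v uS m0 gX indX ei.
have {}PB : (P B <= delta%:E)%E.
  apply: le_trans PB _; rewrite lee_fin; apply: le_trans fail.
  rewrite big_sumType/= !sumr_const !card_prod card_tuple card_prod !card_ord card_bool.
  rewrite -[X in X + _ <= _]mulr_natl -[X in _ + X <= _]mulr_natl !natrM natrX natrM.
  rewrite le_eqVlt; apply/orP; left; apply/eqP.
  by rewrite (mulrC n%:R 2); ring.
exists (~` B)%classic.
  split; first exact: measurableC.
  by rewrite probability_setC// EFinB leeB.
move=> t Bt x E.
have good b : good_sample Sigma (emp_cov (x b)) (1 / 400) e0 N.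
  split=> [j U q|i j k q].
    exact: (hB t Bt b (inl (j, U, q))).
  exact: (hB t Bt b (inr (i, j, k, q))).
apply: (@hybrid_mb_correct _ _ _ _ N) => //.
by move=> i; rewrite -dmax /max_degree (bigD1 i)//= leq_maxl.
Qed.
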